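(* Let $Q>1$ and let $(\Omega,d,\mu)$ be a locally compact, $c$-quasiconvex, Ahlfors $Q$-regular incomplete metric measure space. Let $\varphi:[0,\infty)\to[0,\infty)$ be a homeomorphism. Assume that $(\Omega,k)$ is roughly starlike Gromov hyperbolic and that $(\Omega,d)$ is $\varphi$-uniform, where $k$ is the quasihyperbolic metric of $\Omega$. (1) If $\Omega$ is bounded and $\int_1^\infty\frac{dt}{\varphi^{-1}(t)}<\infty$, then the Gromov boundary and the metric boundary $\partial\Omega$ of $\Omega$ are homeomorphic. (2) If $\Omega$ is unbounded and $\int_1^\infty\frac{dt}{\sqrt{\varphi^{-1}(t)}}<\infty$, then the Gromov boundary of $\Omega$ and $\partial\Omega\cup\{\infty\}$ are homeomorphic, where $\overline\Omega\cup\{\infty\}$ is the one point compactification of the metric completion $\overline\Omega$ of $(\Omega,d)$ and $\partial\Omega\cup\{\infty\}=(\overline\Omega\cup\{\infty\})\setminus\Omega$.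
   Context: $\overline\Omega$ is the metric completion of $(\Omega,d)$ and $\partial\Omega=\overline\Omega\setminus\Omega$ its metric boundary; incomplete means $\partial\Omega\ne\emptyset$. $(\Omega,d)$ is $c$-quasiconvex ($c\ge1$) if each pair of points $x,y$ can be joined by a curve of length at most $c\,d(x,y)$. $(\Omega,d,\mu)$ is Ahlfors $Q$-regular if $\mu$ is a positive Borel measure and there is $C\ge1$ with $C^{-1}R^Q\le\mu(B(x,R))\le CR^Q$ for all $x\in\Omega$ and $0<R<\operatorname{diam}(\Omega)$ (possibly infinite diameter). Put $d_\Omega(x)=\operatorname{dist}(x,\partial\Omega)$. The quasihyperbolic metric is $k(x,y)=\inf\int_\gamma\frac{|dz|}{d_\Omega(z)}$, the infimum over rectifiable curves $\gamma$ in $\Omega$ joining $x$ and $y$ (arc-length integral). $(\Omega,d)$ is $\varphi$-uniform if $k(x,y)\le\varphi\left(\frac{d(x,y)}{\min\{d_\Omega(x),d_\Omega(y)\}}\right)$ for all $x,y\in\Omega$. $(\Omega,k)$ is Gromov hyperbolic if there is $\delta\ge0$ with $(x|y)_w\ge\min\{(x|z)_w,(z|y)_w\}-\delta$ for all $x,y,z,w$, where $(x|y)_w=\frac12[k(x,w)+k(y,w)-k(x,y)]$. Under the hypotheses $(\Omega,k)$ is a proper geodesic space. It is roughly starlike if there are $w\in\Omega$ and $K\ge0$ such that for each $x\in\Omega$ there is a geodesic ray $\gamma$ of $(\Omega,k)$ emanating from $w$ (to some point of the Gromov boundary) with $\operatorname{dist}_k(x,\gamma)\le K$. The Gromov boundary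 of $\Omega$ is the Gromov boundary $\partial_\infty\Omega$ of $(\Omega,k)$: the set of equivalence classes of sequences $\{x_i\}$ with $(x_i|x_j)_w\to\infty$ as $i,j\to\infty$, where $\{x_i\}\sim\{y_i\}$ if $(x_i|y_i)_w\to\infty$. With $(\xi|\eta)_w=\inf\{\liminf_i(a_i|b_i)_w:\{a_i\}\in\xi,\{b_i\}\in\eta\}$, it carries the topology of any Bourdon metric $d_{w,\varepsilon}(\xi,\zeta)=\inf\sum_{i=1}^n e^{-\varepsilon(\xi_{i-1}|\xi_i)_w}$ (infimum over finite chains $\xi=\xi_0,\dots,\xi_n=\zeta$ in $\partial_\infty\Omega$; $0<\varepsilon<\min\{1,\frac1{5\delta}\}$; $e^{-\infty}=0$). The metric boundary $\partial\Omega$ carries the topology induced by $d$, and $\partial\Omega\cup\{\infty\}$ the subspace topology from the one point compactification. *)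

(* Defs.v *)
From HB Require Import structures.
From mathcomp Require Import all_boot all_order all_algebra.
From mathcomp Require Import all_classical all_reals all_analysis.

Set Implicit Arguments.
Unset Strict Implicit.
Unset Printing Implicit Defensive.

Import Order.TTheory GRing.Theory Num.Theory.
Import numFieldNormedType.Exports.

Local Open Scope classical_set_scope.
Local Open Scope ring_scope.

(* The library's measurable types are pointed, hence the nonempty metric
   spaces below. *)
#[short(type="pmetricType")]
HB.structure Definition PointedMetric (R : numDomainType) :=
  {T of Pointed T & Metric R T}.

Definition borel (T : topologicalType) := g_sigma_algebraType (@open T).

Definition homeomorphic (X Y : topologicalType) : Prop :=
  exists (f : X -> Y) (g : Y -> X),
    [/\ cancel f g, cancel g f, continuous f & continuous g].

(* The topology generated by the balls of a distance function d; the metric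
   topology when d is a metric. *)
Definition dist_space {R : realType} {T : Type} (d : T -> T -> R) : Type := T.

Section dist_space.
Context {R : realType} {T : choiceType} (d : T -> T -> R).

Definition dist_open (U : set T) : Prop :=
  forall x, U x -> exists2 r : R, 0 < r & forall y, d x y < r -> U y.

Lemma dist_openT : dist_open setT.
Proof. by move=> x _; exists 1. Qed.

Lemma dist_openI : setI_closed dist_open.
Proof.
move=> A B oA oB x [/oA[r r0 rA] /oB[s s0 sB]].
exists (Num.min r s); first by rewrite lt_min r0 s0.
by move=> y; rewrite lt_min => /andP[yr ys]; split; [exact: rA|exact: sB].
Qed.

Lemma dist_open_bigU (I : Type) (f : I -> set T) :
  (forall i, dist_open (f i)) -> dist_open (\bigcup_i f i).
Proof.
move=> of_ x [i _ /of_[r r0 rf]]; exists r => // y /rf fy.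
by exists i.
Qed.

HB.instance Definition _ := Choice.on (dist_space d).
HB.instance Definition _ := isOpenTopological.Build (dist_space d)
  dist_openT dist_openI dist_open_bigU.

End dist_space.

Section curves.
Context {R : realType} {T : metricType R}.

Definition metric_diam : \bar R :=
  ereal_sup [set (mdist p.1 p.2)%:E | p in [set: T * T]].

Definition is_curve (g : R -> T) : Prop := {within `[0, 1], continuous g}.

Definition curve_length (a b : R) (g : R -> T) : \bar R :=
  ereal_sup [set (\sum_(0 <= i < size s)
                   mdist (g (nth b (a :: s) i)) (g (nth b (a :: s) i.+1)))%:E
            | s in itv_partition a b].

Definition rectifiable (g : R -> T) : Prop := (curve_length 0 1 g < +oo)%E.

(* g_s(s) := g(t) for any t with l(g|[0,t]) = s; g is constant on the set of
   such t. *)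
Definition arclength_param (g : R -> T) (s : R) : T :=
  g (inf [set t | 0 <= t <= 1 /\ curve_length 0 t g = s%:E]).

Definition line_integral (rho : T -> R) (g : R -> T) : \bar R :=
  \int[lebesgue_measure]_(s in `[0, fine (curve_length 0 1 g)])
    (rho (arclength_param g s))%:E.

Definition quasiconvex (c : R) : Prop :=
  forall x y : T, exists g : R -> T,
    [/\ is_curve g, g 0 = x, g 1 = y &
        (curve_length 0 1 g <= (c * mdist x y)%:E)%E].

Definition ahlfors_regular (Q : R) (mu : set T -> \bar R) : Prop :=
  exists2 C : R, 1 <= C & forall (x : T) (r : R),
    0 < r -> (r%:E < metric_diam)%E ->
    ((C^-1 * r `^ Q)%:E <= mu (ball x r) <= (C * r `^ Q)%:E)%E.

End curves.
Arguments metric_diam {R} T.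
Arguments quasiconvex {R} T c.

Section completion.
Context {R : realType} {T S : metricType R} (iota : T -> S).

(* S, with the embedding iota of T, is a metric completion of T; it is unique
   up to an isometry fixing T. *)
Definition is_completion : Prop :=
  [/\ forall x y, mdist (iota x) (iota y) = mdist x y,
      dense (range iota) &
      forall F : set_system S, ProperFilter F -> cauchy F ->
        exists l : S, F --> l].

Definition metric_boundary : set S := ~` range iota.

Definition boundary_dist (x : T) : R :=
  inf [set mdist (iota x) z | z in metric_boundary].

(* The infimum is finite when T is locally compact and quasiconvex. *)
Definition quasihyperbolic (x y : T) : R :=
  fine (ereal_inf
    [set line_integral (fun z => (boundary_dist z)^-1) g
    | g in [set g : R -> T |
        [/\ is_curve g, rectifiable g, g 0 = x & g 1 = y]]]).

Definition phi_uniform (phi : R -> R) : Prop :=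
  forall x y, quasihyperbolic x y <=
    phi (mdist x y / Num.min (boundary_dist x) (boundary_dist y)).

(* The remainder of T in the one-point compactification of S, that is,
   metric_boundary together with the point at infinity. *)
Definition extended_boundary : set (one_point_compactification S) :=
  ~` range (Some \o iota).

End completion.

(* phi is a homeomorphism of [0, +oo[ with inverse psi. *)
Definition nneg_homeo {R : realType} (phi psi : R -> R) : Prop :=
  [/\ forall t, 0 <= t -> 0 <= phi t /\ psi (phi t) = t,
      forall t, 0 <= t -> 0 <= psi t /\ phi (psi t) = t,
      {within `[0, +oo[, continuous phi} &
      {within `[0, +oo[, continuous psi}].

Section gromov.
Context {R : realType} {T : Type} (k : T -> T -> R).

Definition gromov_product (w x y : T) : R := (k x w + k y w - k x y) / 2.

Definition gromov_delta (delta : R) : Prop :=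
  forall x y z w, Num.min (gromov_product w x z) (gromov_product w z y) - delta
    <= gromov_product w x y.

Definition gromov_hyperbolic : Prop :=
  exists2 delta : R, 0 <= delta & gromov_delta delta.

Definition geodesic_ray (w : T) (g : R -> T) : Prop :=
  g 0 = w /\ forall s t : R, 0 <= s -> 0 <= t -> k (g s) (g t) = `|s - t|.

Definition roughly_starlike : Prop :=
  exists (w : T) (K : R), 0 <= K /\
    forall x, exists2 g, geodesic_ray w g &
      inf [set k x (g t) | t in `[0, +oo[] <= K.

Definition gromov_sequence (w : T) (a : nat -> T) : Prop :=
  gromov_product w (a ij.1) (a ij.2) @[ij --> (\oo, \oo)] --> +oo.

Definition gromov_equiv (w : T) (a b : nat -> T) : Prop :=
  gromov_product w (a i) (b i) @[i --> \oo] --> +oo.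

Definition gromov_classes (w : T) : set (set (nat -> T)) :=
  [set [set b | gromov_sequence w b /\ gromov_equiv w a b]
  | a in gromov_sequence w].

Definition boundary_product (w : T) (xi eta : gromov_classes w) : \bar R :=
  ereal_inf [set limn_einf (fun i => (gromov_product w (a i) (b i))%:E)
            | a in set_val xi & b in set_val eta].

Definition bourdon_dist (w : T) (eps : R) (xi zeta : gromov_classes w) : R :=
  inf [set r | exists (n : nat) (c : nat -> gromov_classes w),
    [/\ (0 < n)%N, c 0%N = xi, c n = zeta &
      r = \sum_(0 <= i < n)
            fine (expeR (- (eps%:E * boundary_product (c i) (c i.+1))))]].

(* eps < 1 / (5 delta), with 1 / 0 = +oo *)
Definition bourdon_parameter (eps : R) : Prop :=
  exists delta : R, [/\ 0 <= delta, gromov_delta delta,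
    0 < eps < 1 & eps * (5 * delta) < 1].

(* The Gromov boundary, with the topology of d_{w,eps}. *)
Definition gromov_boundary (w : T) (eps : R) : topologicalType :=
  dist_space (@bourdon_dist w eps).

End gromov.

(* Main.v *)
(* Along a quasihyperbolic geodesic ray from the starlikeness center, the
   phi-uniformity bounds the distance to the boundary at time t by
   D / psi(t), where D bounds the metric.  As 1 / psi is integrable, rays have
   finite length and the tails are uniformly small, so points with a large
   Gromov product are close to each other and to the boundary.  Conversely,
   assume that x and y are close to each other and to the boundary but have a
   bounded Gromov product.  For points at times s and t on the rays towards x
   and y the quasihyperbolic distance is s + t up to a constant, so psi(s + t)
   times the smaller of the two distances to the boundary is at most the sum
   of the remaining tails.  Matching the times at which the tails shrink by a
   fixed factor, each such scale uses up a definite part of the convergent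
   series of 1 / psi; hence there are boundedly many scales and the tails
   cannot become small.  These two facts make "limit of a Gromov sequence" a
   homeomorphism onto the metric boundary; no Gehring-Hayman inequality is
   involved.  For unbounded spaces the same argument applies to
   d(x,y) h(x) h(y) with h(x) = 1 / (1 + d(o,x)) and to the weight
   d_Omega(x) h(x)^2; passing to it replaces psi by its square root.  Ahlfors
   regularity is used there to make closed balls of the completion compact,
   so that h tends to 0 exactly at the point at infinity. *)

Require Import Defs.
From mathcomp Require Import all_boot all_order all_algebra.
From mathcomp Require Import ring lra zify.
From mathcomp Require Import all_classical all_reals all_analysis measurable_realfun.

Set Implicit Arguments.
Unset Strict Implicit.
Unset Printing Implicit Defensive.

Import Order.TTheory GRing.Theory Num.Theory.
Import numFieldNormedType.Exports.

Local Open Scope classical_set_scope.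
Local Open Scope ring_scope.

(** * Length of curves *)

(** For the converse half, uniformity bounds only the smaller of the two weights at times i and j,
    so neither ray can be estimated alone, and the two rays may lose weight at unrelated speeds. The
    remedy is a walk on the grid of pairs of integer times: at each pair, the ray whose weight is
    the bounded one advances. Then i + j grows with every move, each term of the series of 1 / psi
    is spent at most once, and one of the two rays gets summed completely. Summation along a ray
    needs chains of unbounded length, for which a quasi-triangle inequality would lose a factor at
    every step. The assumption on the quasimetric q is therefore an inequality for chains of any
    length with a single constant: 1 for the distance, 4 for its sphericalization. With it the
    bounded and the unbounded case are instances of one statement about a weight F and a quasimetric
    q on (Omega, k). Their link to k is a growth bound: q(x,y) and F(y) are at most F(x) E(k(x,y)),
    which goes back to the fact that d_Omega grows with slope at most 1 along a curve. *)

Section chain_length.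
Context {R : realType} {T : metricType R}.
Implicit Types (g : R -> T) (a b c : R) (s t : seq R).

Lemma itv_partition0 a : itv_partition a a [::].
Proof. by split; rewrite /= ?eqxx. Qed.

(** The inscribed sum of [curve_length], in recursive form so that inductions on the partition need
    no index arithmetic. *)
Fixpoint chain_length g a s : R :=
  if s is x :: t then mdist (g a) (g x) + chain_length g x t else 0.

Lemma chain_lengthE g a b s :
  \sum_(0 <= i < size s)
     mdist (g (nth b (a :: s) i)) (g (nth b (a :: s) i.+1)) = chain_length g a s.
Proof.
elim: s a => [|x s ih] a; first by rewrite big_nil.
by rewrite /= big_nat_recl //= ih.
Qed.

Lemma curve_lengthE g a b :
  curve_length a b g =
  ereal_sup [set (chain_length g a s)%:E | s in itv_partition a b].
Proof.
rewrite /curve_length; congr ereal_sup; apply/seteqP.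
by split=> _ [s ps <-]; exists s => //; rewrite chain_lengthE.
Qed.

Lemma chain_length_ge0 g a s : 0 <= chain_length g a s.
Proof. by elim: s a => //= x s ih a; rewrite addr_ge0 ?mdist_ge0. Qed.

Lemma chain_length_cat g a s t :
  chain_length g a (s ++ t) = chain_length g a s + chain_length g (last a s) t.
Proof. by elim: s a => [|x s ih] a /=; rewrite ?add0r // ih addrA. Qed.

(** Inserting [c] as a further partition point cannot decrease the sum, by the triangle inequality;
    length is therefore subadditive. *)
Lemma chain_length_split g a b c s : a <= c -> c <= b -> itv_partition a b s ->
  exists s1 s2, [/\ itv_partition a c s1, itv_partition c b s2 &
    chain_length g a s <= chain_length g a s1 + chain_length g c s2].
Proof.
elim: s a => [|x s ih] a ac cb ps.
  have ab := itv_partition_nil ps.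
  have ac' : a = c by apply/le_anti; rewrite ac ab cb.
  by exists [::], [::]; split; rewrite /= ?addr0 -?ac' ?ab //; exact: itv_partition0.
have [xc|cx] := leP x c.
  have [s1 [s2 [p1 p2 h]]] := ih x xc cb (itv_partition_cons ps).
  exists (x :: s1), s2; split => //; last by rewrite /= -addrA lerD2l.
  by case: p1 => h1 h2; case: ps => /= /andP[ax _] _; split => //=; rewrite ax.
move: ac; rewrite le_eqVlt => /predU1P[ac|ac].
  rewrite -ac; exists [::], (x :: s); split; rewrite /= ?add0r //.
exists [:: c], (x :: s); split => //=; first exact: itv_partition1.
  by case: ps => /= /andP[_ h1] h2; split; rewrite //= cx.
by rewrite addr0 addrA lerD2r metric_triangle.
Qed.

Lemma chain_length_le g a b s : itv_partition a b s ->
  ((chain_length g a s)%:E <= curve_length a b g)%E.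
Proof. by move=> ps; rewrite curve_lengthE; apply: ereal_sup_ubound; exists s. Qed.

Lemma curve_length_ge_dist g a b : a <= b ->
  ((mdist (g a) (g b))%:E <= curve_length a b g)%E.
Proof.
rewrite le_eqVlt => /predU1P[<-|ab].
  rewrite mdistxx; apply: le_trans (@chain_length_le g a a [::] _) => //.
by have := chain_length_le g (itv_partition1 ab); rewrite /= addr0.
Qed.

Lemma curve_length_ge0 g a b : a <= b -> (0 <= curve_length a b g)%E.
Proof.
by move=> ab; apply: le_trans (curve_length_ge_dist g ab); rewrite lee_fin mdist_ge0.
Qed.

Lemma curve_lengthxx g a : curve_length a a g = 0%E.
Proof.
apply/le_anti; rewrite curve_length_ge0 // andbT curve_lengthE.
by apply: ge_ereal_sup => _ [s /itv_partitionxx -> <-].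
Qed.

Lemma curve_lengthD g a b c : a <= c -> c <= b ->
  curve_length a b g = (curve_length a c g + curve_length c b g)%E.
Proof.
move=> ac cb; apply/le_anti/andP; split.
  rewrite [leLHS]curve_lengthE; apply: ge_ereal_sup => _ [s ps <-].
  have [s1 [s2 [p1 p2 h]]] := chain_length_split g ac cb ps.
  apply: le_trans (leeD (chain_length_le g p1) (chain_length_le g p2)).
  by rewrite -EFinD lee_fin.
have [L0 L1 L2] : [/\ (0 <= curve_length a b g)%E,
    (0 <= curve_length a c g)%E & (0 <= curve_length c b g)%E].
  by split; apply: curve_length_ge0 => //; exact: le_trans ac cb.
have [->|Lfin] := eqVneq (curve_length a b g) +oo%E; first by rewrite leey.
have {}Lfin : curve_length a b g \is a fin_num by rewrite ge0_fin_numE // ltey.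
have cat s1 s2 : itv_partition a c s1 -> itv_partition c b s2 ->
    ((chain_length g a s1)%:E + (chain_length g c s2)%:E <= curve_length a b g)%E.
  move=> p1 p2; apply: le_trans (chain_length_le g (itv_partition_cat p1 p2)).
  by rewrite chain_length_cat; case: p1 => _ /eqP ->; rewrite EFinD.
have half s2 : itv_partition c b s2 ->
    (curve_length a c g + (chain_length g c s2)%:E <= curve_length a b g)%E.
  move=> p2; rewrite -leeBrDr // curve_lengthE.
  by apply: ge_ereal_sup => _ [s1 p1 <-]; rewrite leeBrDr // cat.
(* The first piece has to be finite before it can change sides and the supremum over the second
   partitions be taken. *)
have acfin : curve_length a c g \is a fin_num.
  rewrite ge0_fin_numE //; have [s ps] : exists s, itv_partition c b s.
    move: cb; rewrite le_eqVlt => /predU1P[->|cb].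
      by exists [::]; exact: itv_partition0.
    by exists [:: b]; exact: itv_partition1.
  apply: le_lt_trans (_ : curve_length a b g < +oo)%E; last first.
    by rewrite -ge0_fin_numE.
  apply: le_trans (half _ ps); rewrite leeDl // lee_fin; exact: chain_length_ge0.
rewrite addeC -leeBrDr // [leLHS]curve_lengthE.
by apply: ge_ereal_sup => _ [s ps <-]; rewrite leeBrDr // addeC half.
Qed.

End chain_length.

(** * Continuity of the length function and the arc length parametrization *)

Section arclength.
Context {R : realType} {T : metricType R}.
Implicit Types g : R -> T.

Lemma itv01_cvgP g t : is_curve g -> 0 <= t <= 1 -> forall e : R, 0 < e ->
  exists2 d : R, 0 < d & forall u, 0 <= u <= 1 -> `|t - u| < d ->
    mdist (g t) (g u) < e.
Proof.
move=> /subspace_continuousP cg t01 e e0.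
have := cg t; rewrite /= in_itv /= => /(_ t01).
move=> /metricType_numDomainType.cvgrPdist_lt /(_ e e0).
rewrite near_withinE => -[d /= d0 h]; exists d => // u u01 tu.
by apply: h => //=; rewrite in_itv.
Qed.

(** Serves the symmetry of the quasihyperbolic metric. *)
Definition reverse g : R -> T := fun t => g (1 - t).

Lemma reverseK g : reverse (reverse g) = g.
Proof. by apply/funext => t; rewrite /reverse subKr. Qed.

Lemma is_curve_reverse g : is_curve g -> is_curve (reverse g).
Proof.
move=> cg; apply/subspace_continuousP => t /=; rewrite in_itv /= => t01.
apply/metricType_numDomainType.cvgrPdist_lt => e e0.
have [|d d0 h] := itv01_cvgP cg (_ : 0 <= 1 - t <= 1) e0; first by lra.
rewrite near_withinE; exists d => //= u /= tu; rewrite in_itv /= => u01.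
apply: h; first lra.
by rewrite (_ : 1 - t - (1 - u) = - (t - u)) ?normrN //; lra.
Qed.

(** A partition whose sum exceeds [m] by [e] still exceeds [m] when its last point moves from [t] to
    a nearby [u], since continuity of [g] lowers only the last summand, by less than [e]. *)
Lemma curve_length_lsc_left g a t : is_curve g -> 0 <= a -> a < t -> t <= 1 ->
  forall m : R, (m%:E < curve_length a t g)%E ->
  exists2 d : R, 0 < d & forall u, a <= u <= t -> t - u < d ->
    (m%:E < curve_length a u g)%E.
Proof.
move=> cg a0 at_ t1 m; rewrite curve_lengthE => /ereal_sup_gt[_ [s ps <-]].
rewrite lte_fin => ms.
have [e e0 hs] : exists2 e : R, 0 < e & m + e <= chain_length g a s.
  by exists (chain_length g a s - m); lra.
have t01 : 0 <= t <= 1 by lra.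
have [d d0 h] := itv01_cvgP cg t01 e0.
case/lastP: s ps hs {ms} => [/itv_partition_nil E|s x ps]; first by lra.
have xt : x = t by case: ps => _; rewrite last_rcons => /eqP.
rewrite {x}xt in ps *.
rewrite -cats1 chain_length_cat /= addr0 => hs.
have pt : last a s < t.
  by case: ps => + _; rewrite rcons_path => /andP[].
exists (Num.min d (t - last a s)); first by rewrite lt_min d0 subr_gt0.
move=> u au; rewrite lt_min => /andP[ud us].
have pu : itv_partition a u (rcons s u).
  split; last by rewrite last_rcons.
  by case: ps; rewrite !rcons_path => /andP[-> _] _ /=; lra.
apply: lt_le_trans (chain_length_le g pu).
rewrite -cats1 chain_length_cat /= addr0 lte_fin.
have tu : mdist (g t) (g u) < e.
  by apply: h; [lra|rewrite ger0_norm; lra].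
have := metric_triangle (g (last a s)) (g u) (g t).
by rewrite (metric_sym (g u)); lra.
Qed.

Lemma curve_length_lsc_right g t b : is_curve g -> 0 <= t -> t < b -> b <= 1 ->
  forall m : R, (m%:E < curve_length t b g)%E ->
  exists2 d : R, 0 < d & forall u, t <= u <= b -> u - t < d ->
    (m%:E < curve_length u b g)%E.
Proof.
move=> cg t0 tb b1 m; rewrite curve_lengthE => /ereal_sup_gt[_ [s ps <-]].
rewrite lte_fin => ms.
have [e e0 hs] : exists2 e : R, 0 < e & m + e <= chain_length g t s.
  by exists (chain_length g t s - m); lra.
have t01 : 0 <= t <= 1 by lra.
have [d d0 h] := itv01_cvgP cg t01 e0.
case: s ps hs {ms} => [/itv_partition_nil E|x s ps /= hs]; first by lra.
have tx : t < x by case: ps => /= /andP[].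
exists (Num.min d (x - t)); first by rewrite lt_min d0 subr_gt0.
move=> u ub; rewrite lt_min => /andP[ud us].
have pu : itv_partition u b (x :: s).
  by case: ps => /= /andP[_ ps] pb; split => //=; rewrite ps andbT; lra.
apply: lt_le_trans (chain_length_le g pu); rewrite /= lte_fin.
have tu : mdist (g t) (g u) < e.
  by apply: h; [lra|rewrite ler0_norm; lra].
by have := metric_triangle (g t) (g u) (g x); lra.
Qed.

Definition length_upto g (t : R) : R := fine (curve_length 0 t g).

Section rectifiable_curve.
Variable g : R -> T.
Hypotheses (cg : is_curve g) (rg : rectifiable g).
Local Notation v := (length_upto g).

Lemma curve_length_fin s t : 0 <= s -> s <= t -> t <= 1 ->
  curve_length s t g \is a fin_num.
Proof.
move=> s0 st t1; rewrite ge0_fin_numE ?curve_length_ge0 //.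
apply: le_lt_trans rg; rewrite (@curve_lengthD _ _ g 0 1 s) //; last lra.
rewrite (@curve_lengthD _ _ g s 1 t) // addeCA.
by rewrite leeDl // adde_ge0 // curve_length_ge0.
Qed.

Lemma length_uptoE t : 0 <= t -> t <= 1 -> curve_length 0 t g = (v t)%:E.
Proof. by move=> t0 t1; rewrite fineK // curve_length_fin. Qed.

Lemma curve_length_upto s t : 0 <= s -> s <= t -> t <= 1 ->
  curve_length s t g = (v t - v s)%:E.
Proof.
move=> s0 st t1.
have := @curve_lengthD _ _ g 0 t s s0 st.
rewrite !length_uptoE //; [|lra..].
rewrite -(fineK (curve_length_fin s0 st t1)) -EFinD => -[->].
by congr EFin; lra.
Qed.

Lemma length_upto0 : v 0 = 0.
Proof. by rewrite /length_upto curve_lengthxx. Qed.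

Lemma length_upto_dist s t : 0 <= s -> s <= t -> t <= 1 ->
  mdist (g s) (g t) <= v t - v s.
Proof.
by move=> s0 st t1; rewrite -lee_fin -curve_length_upto // curve_length_ge_dist.
Qed.

Lemma length_upto_homo s t : 0 <= s -> s <= t -> t <= 1 -> v s <= v t.
Proof.
move=> s0 st t1; have := length_upto_dist s0 st t1.
by have := mdist_ge0 (g s) (g t); lra.
Qed.

(** A monotone function is continuous once it has no jumps. Lower semicontinuity of the length over
    [[0, u]] excludes a jump from the left; that of the length over [[u, 1]], turned around by
    additivity, one from the right. *)
Lemma length_upto_continuous : {within `[0, 1], continuous v}.
Proof.
apply/subspace_continuousP => t /=; rewrite in_itv /= => t01.
apply/cvgrPdist_lt => e e0.
have [d1 d10 h1] : exists2 d : R, 0 < d &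
    forall u, 0 <= u <= t -> t - u < d -> v t - e < v u.
  have [t0|t0] := leP t 0.
    by exists 1 => // u ut _; rewrite (_ : u = t); lra.
  have [||||d d0 h] := @curve_length_lsc_left g 0 t cg _ _ _ (v t - e) => //.
  - by lra.
  - by rewrite length_uptoE ?lte_fin; lra.
  exists d => // u ut td; have := h u ut td.
  by rewrite length_uptoE ?lte_fin; lra.
have [d2 d20 h2] : exists2 d : R, 0 < d &
    forall u, t <= u <= 1 -> u - t < d -> v u < v t + e.
  have [t1|t1] := leP 1 t.
    by exists 1 => // u ut _; rewrite (_ : u = t); lra.
  have [||||d d0 h] := @curve_length_lsc_right g t 1 cg _ _ _ (v 1 - v t - e) => //.
  - by lra.
  - by rewrite curve_length_upto ?lte_fin; lra.
  exists d => // u ut td; have := h u ut td.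
  by rewrite curve_length_upto ?lte_fin; lra.
rewrite near_withinE; exists (Num.min d1 d2) => /=; first by rewrite lt_min d10.
move=> u /=; rewrite lt_min in_itv /= => /andP[ud1 ud2] u01.
have [ut|tu] := leP u t.
  have {}ud1 : t - u < d1 by apply: le_lt_trans ud1; exact: ler_norm.
  have vut : v u <= v t by apply: length_upto_homo; lra.
  have vt : v t - e < v u by apply: h1; lra.
  suff: `|v t - v u| < e by [].
  by rewrite ger0_norm; lra.
have {}ud2 : u - t < d2 by apply: le_lt_trans ud2; rewrite -normrN opprB; exact: ler_norm.
have vut : v t <= v u by apply: length_upto_homo; lra.
have vt : v u < v t + e by apply: h2; lra.
suff: `|v t - v u| < e by [].
by rewrite ler0_norm; lra.
Qed.

Lemma length_upto_surj s : 0 <= s <= v 1 ->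
  exists2 t, 0 <= t <= 1 & v t = s.
Proof.
move=> s01.
have [||t] := @IVT R v 0 1 s _ length_upto_continuous; first by [].
  rewrite length_upto0 min_l ?max_r //; lra.
by rewrite in_itv /= => t01 ts; exists t.
Qed.

(** [g] takes the same value at all times of equal length; these times approximate their infimum, so
    continuity carries the value there. *)
Lemma arclength_param_upto (t : R) : 0 <= t <= 1 -> arclength_param g (v t) = g t.
Proof.
move=> t01; rewrite /arclength_param.
set A := [set u | _]; set u := inf A.
have At : A t by split => //; rewrite length_uptoE //; lra.
have Alb : lbound A 0 by move=> x [/andP[]].
have Ai : has_inf A by split; [exists t|exists 0].
have u0 : 0 <= u by apply: lb_le_inf => //; exists t.
have ut : u <= t by apply: ge_inf => //; exists 0.
have u01 : 0 <= u <= 1 by lra.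
apply: mdist_positivity; apply/eqP; rewrite eq_le mdist_ge0 andbT.
apply/ler_addgt0Pr => e e0; rewrite add0r; apply: ltW.
have [d d0 h] := itv01_cvgP cg u01 e0.
have [w [w01]] := inf_adherent d0 Ai; rewrite -/u => wv wd.
have uw : u <= w by apply: ge_inf; [exists 0|split].
have {}wv : v w = v t by move: wv; rewrite length_uptoE; [case|lra|lra].
have wt : mdist (g w) (g t) = 0.
  apply/eqP; rewrite eq_le mdist_ge0 andbT.
  have [wt|tw] := leP w t.
    by apply: le_trans (length_upto_dist _ wt _) _; rewrite ?wv ?subrr //; lra.
  rewrite metric_sym.
  by apply: le_trans (length_upto_dist _ (ltW tw) _) _; rewrite ?wv ?subrr //; lra.
have := metric_triangle (g u) (g w) (g t); rewrite wt addr0.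
by move=> /le_lt_trans; apply; apply: h => //; rewrite ler0_norm; lra.
Qed.

Lemma arclength_param_lip s s' : 0 <= s <= v 1 -> 0 <= s' <= v 1 ->
  mdist (arclength_param g s) (arclength_param g s') <= `|s - s'|.
Proof.
move=> /length_upto_surj[t t01 <-] /length_upto_surj[t' t'01 <-].
rewrite !arclength_param_upto //.
have [tt|tt] := leP t t'.
  apply: le_trans (length_upto_dist _ tt _) _; [lra|lra|].
  by rewrite distrC ler_norm.
rewrite metric_sym.
by apply: le_trans (length_upto_dist _ (ltW tt) _) _; [lra|lra|rewrite ler_norm].
Qed.

End rectifiable_curve.

Lemma chain_length_reverse g a b s : itv_partition a b s ->
  exists2 s', itv_partition (1 - b) (1 - a) s' &
    chain_length g a s = chain_length (reverse g) (1 - b) s'.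
Proof.
elim: s a => [|x s ih] a ps.
  rewrite (itv_partition_nil ps); exists [::] => //; exact: itv_partition0.
have [s' ps' e] := ih x (itv_partition_cons ps).
have ax : a < x by case: ps => /= /andP[].
exists (s' ++ [:: 1 - a]).
  by apply: itv_partition_cat ps' _; apply: itv_partition1; lra.
rewrite chain_length_cat /= addr0 e addrC; congr (_ + _).
case: ps' => _ /eqP ->; rewrite /reverse !subKr; exact: metric_sym.
Qed.

Lemma curve_length_reverse g a b :
  curve_length a b g = curve_length (1 - b) (1 - a) (reverse g).
Proof.
have half h c d : (curve_length c d h <= curve_length (1 - d) (1 - c) (reverse h))%E.
  rewrite [leLHS]curve_lengthE; apply: ge_ereal_sup => _ [s ps <-].
  by have [s' ps' ->] := chain_length_reverse h ps; exact: chain_length_le.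
by apply/le_anti; rewrite half /=; have := half (reverse g) (1 - b) (1 - a);
  rewrite reverseK !subKr.
Qed.

Lemma rectifiable_reverse g : rectifiable g -> rectifiable (reverse g).
Proof. by rewrite /rectifiable (curve_length_reverse g) subrr subr0. Qed.

Lemma length_upto_reverse g t : rectifiable g -> 0 <= t <= 1 ->
  length_upto (reverse g) (1 - t) = length_upto g 1 - length_upto g t.
Proof.
move=> rg t01; rewrite {1}/length_upto.
rewrite -[X in curve_length X](subrr 1) -curve_length_reverse.
by rewrite curve_length_upto //; lra.
Qed.

Lemma arclength_param_reverse g s : is_curve g -> rectifiable g ->
  0 <= s <= length_upto g 1 ->
  arclength_param (reverse g) (length_upto g 1 - s) = arclength_param g s.
Proof.
move=> cg rg /length_upto_surj[//|//|t t01 <-].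
rewrite -length_upto_reverse // !arclength_param_upto //.
- by rewrite /reverse subKr.
- exact: is_curve_reverse.
- exact: rectifiable_reverse.
- lra.
Qed.

End arclength.

(** * The quasihyperbolic metric *)

Section boundary_distance.
Context {R : realType} {T S : metricType R} (iota : T -> S).
Hypothesis iota_isom : forall x y, mdist (iota x) (iota y) = mdist x y.
Hypothesis boundary_neq0 : metric_boundary iota !=set0.
Local Notation f := (boundary_dist iota).

Lemma boundary_dist_has_inf x :
  has_inf [set mdist (iota x) z | z in metric_boundary iota].
Proof.
split; first by have [z Bz] := boundary_neq0; exists (mdist (iota x) z), z.
by exists 0 => _ [z _ <-]; exact: mdist_ge0.
Qed.

Lemma boundary_dist_le x z : metric_boundary iota z -> f x <= mdist (iota x) z.
Proof.
by move=> Bz; apply: ge_inf; [case: (boundary_dist_has_inf x)|exists z].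
Qed.

Lemma boundary_dist_lip x y : f x <= f y + mdist x y.
Proof.
rewrite -lerBlDr; apply: lb_le_inf; first by case: (boundary_dist_has_inf y).
move=> _ [z Bz <-]; rewrite lerBlDr addrC.
apply: le_trans (boundary_dist_le x Bz) _.
by rewrite -iota_isom metric_triangle.
Qed.

(** The image of a compact neighbourhood of [x] is closed in the completion. A boundary point closer
    than [r / 2] to [x] would be a limit of points of that neighbourhood and hence lie in its
    image. *)
Lemma boundary_dist_gt0 : dense (range iota) -> locally_compact [set: T] ->
  forall x, 0 < f x.
Proof.
move=> di lc x.
have [U nU [cU _]] := lc x I.
have {nU} [r r0 rU] : exists2 r : R, 0 < r & forall y, mdist x y < r -> U y.
  have : nbhs x U by move: nU; rewrite withinET.
  move=> /nbhs_ballP[r /= r0 rU]; exists r => // y xy; apply: rU.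
  by rewrite ballEmdist.
have icont : continuous iota.
  move=> y; apply/metricType_numDomainType.cvgrPdist_lt => e e0.
  apply/nbhs_ballP; exists e => //= z; rewrite ballEmdist /= iota_isom //.
have cl : closed (iota @` U).
  apply: compact_closed; first exact: metric_hausdorff.
  by apply: continuous_compact => //; exact: continuous_subspaceT.
suff h z : metric_boundary iota z -> r / 2 <= mdist (iota x) z.
  apply: lt_le_trans (_ : r / 2 <= _); first by rewrite divr_gt0.
  apply: lb_le_inf; first by case: (boundary_dist_has_inf x).
  by move=> _ [z Bz <-]; exact: h.
move=> Bz; rewrite leNgt; apply/negP => xz.
suff : (iota @` U) z by case=> y _ yz; apply: Bz; exists y.
have /closure_id -> := cl; move=> W /nbhs_ballP[e /= e0 eW].
pose e' := Num.min e (r / 2).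
have e'0 : 0 < e' by rewrite lt_min e0 divr_gt0.
have : (ball z e')^° !=set0.
  by exists z; apply: nbhsx_ballx.
move=> /di /(_ (open_interior _))[p [/interior_subset zy [y _ yp]]].
move: zy; rewrite -yp; rewrite ballEmdist /= lt_min => /andP[zy1 zy2].
exists (iota y); split; last by apply: eW; rewrite ballEmdist.
exists y => //; apply: rU; rewrite -iota_isom.
by have := metric_triangle (iota x) z (iota y); lra.
Qed.

End boundary_distance.

(** * Line integrals of a continuous density *)

Section line_integral_theory.
Context {R : realType} {T : metricType R}.
Implicit Types (rho : T -> R) (g : R -> T).

Lemma continuous_arclength_comp rho g :
  continuous rho -> is_curve g -> rectifiable g ->
  {within `[0, length_upto g 1], continuous (rho \o arclength_param g)}.
Proof.
move=> crho cg rg; apply/subspace_continuousP => s /=; rewrite in_itv /= => sL.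
apply: (@cvg_comp _ _ _ (arclength_param g) rho); last exact: crho.
apply/metricType_numDomainType.cvgrPdist_lt => e e0.
rewrite near_withinE; exists e => //= u /= su; rewrite in_itv /= => uL.
exact: le_lt_trans (arclength_param_lip cg rg sL uL) su.
Qed.

Lemma line_integralE rho g :
  line_integral rho g = (\int[lebesgue_measure]_(s in `[0%R, length_upto g 1])
    (rho (arclength_param g s))%:E)%E.
Proof. by []. Qed.

Lemma line_integral_ge0 rho g : (forall x, 0 <= rho x) ->
  (0 <= line_integral rho g)%E.
Proof. by move=> h; apply: integral_ge0 => s _; rewrite lee_fin. Qed.

Lemma line_integral_lty rho g :
  continuous rho -> is_curve g -> rectifiable g -> (line_integral rho g < +oo)%E.
Proof.
move=> crho cg rg; rewrite line_integralE.
have /integrableP[] := continuous_compact_integrable (@segment_compact _ _ _)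
  (continuous_arclength_comp crho cg rg).
move=> mf; apply: le_lt_trans.
apply: le_trans (lee_abs _) _; exact: le_abse_integral.
Qed.

Lemma line_integral_cst rho x : line_integral rho (cst x) = 0%E.
Proof.
rewrite line_integralE.
have -> : length_upto (cst x) (1:R) = 0.
  rewrite /length_upto curve_lengthE.
  rewrite (_ : [set _ | _ in _] = [set 0%E]) ?ereal_sup1 //.
  have z s a : chain_length (cst x) a s = 0 :> R.
    by elim: s a => //= y s ih a; rewrite ih mdistxx addr0.
  apply/seteqP; split => [_ [s _ <-]|_ ->]; first by rewrite z.
  by exists [:: 1]; [exact: itv_partition1|rewrite z].
by rewrite set_itv1 integral_set1.
Qed.

Lemma line_integral_reverse rho g :
  continuous rho -> is_curve g -> rectifiable g ->
  line_integral rho (reverse g) = line_integral rho g.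
Proof.
move=> crho cg rg; rewrite !line_integralE.
set L := length_upto g 1.
have L0 : 0 <= L by rewrite -(@length_upto0 _ _ g) length_upto_homo.
have -> : length_upto (reverse g) 1 = L.
  have := @length_upto_reverse _ _ g 0 rg.
  by rewrite length_upto0 !subr0 lexx ler01; apply.
have [L1|L1] := eqVneq L 0.
  by rewrite L1 set_itv1 !integral_set1.
have dF (x : R) : is_derive x 1 (fun x : R => L - x) (-1).
  by apply: is_derive_eq; rewrite add0r mul1r.
have F' : derive1 (fun x : R => L - x) = cst (-1).
  by apply/funext => x; rewrite derive1E; apply: derive_val.
have cF : continuous (fun x : R => L - x).
  by move=> x; apply: differentiable_continuous; apply/derivable1_diffP/ex_derive.
have := @integration_by_substitution_decreasing R (fun x => L - x)
  (rho \o arclength_param g) 0 L L0.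
rewrite subrr subr0 => -> //.
- apply: eq_integral => s; rewrite inE /= in_itv /= => sL.
  congr EFin; rewrite F' /= opprK mulr1.
  have := @arclength_param_reverse _ _ g (L - s) cg rg.
  by rewrite subKr => -> //; rewrite -/L; lra.
- by move=> s t _ _ st; rewrite ltrD2l ltrN2.
- by rewrite F' => ? _; exact: cvg_cst.
- by rewrite F'; exact: is_cvg_cst.
- by rewrite F'; exact: is_cvg_cst.
- split.
  + by move=> x _; apply: ex_derive.
  + by apply: cvg_at_right_filter; exact: cF.
  + by apply: cvg_at_left_filter; exact: cF.
- exact: continuous_arclength_comp.
Qed.

Lemma continuous_shifted_inv (a L : R) : 0 < a ->
  {within `[0, L], continuous (fun s : R => (a + s)^-1)}.
Proof.
move=> a0; apply/subspace_continuousP => s /=; rewrite in_itv /= => sL.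
apply: cvg_within_filter; apply: cvgV; first lra.
by apply: cvgD; [exact: cvg_cst|exact: cvg_id].
Qed.

Lemma integral_shifted_inv (a L : R) : 0 < a -> 0 < L ->
  (\int[lebesgue_measure]_(s in `[0%R, L]) ((a + s)^-1)%:E =
   (ln (a + L) - ln a)%:E)%E.
Proof.
move=> a0 L0.
have dF (s : R) : 0 <= s -> is_derive s 1 (fun s => ln (a + s)) (a + s)^-1.
  move=> s0; have as0 : 0 < a + s by lra.
  have h1 := is_derive1_ln as0.
  have h2 : is_derive s 1 (fun s : R => a + s) 1.
    by apply: is_derive_eq; rewrite add0r mul1r.
  have := is_derive1_comp h1 h2; rewrite mulr1; exact.
have cF (s : R) : 0 <= s -> {for s, continuous (fun s => ln (a + s))}.
  move=> s0; have := dF s s0 => ?.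
  by apply: differentiable_continuous; apply/derivable1_diffP/ex_derive.
rewrite (@continuous_FTC2 _ _ (fun s => ln (a + s)) 0 L) ?addr0 ?EFinB //.
- exact: continuous_shifted_inv.
- split.
  + move=> s; rewrite in_itv /= => /andP[s0 _].
    by have := dF s (ltW s0) => ?; exact: ex_derive.
  + by apply: cvg_at_right_filter; exact: cF.
  + by apply: cvg_at_left_filter; apply: cF; exact: ltW.
- move=> s; rewrite in_itv /= => /andP[s0 _].
  by have := dF s (ltW s0) => ?; rewrite derive1E derive_val.
Qed.

End line_integral_theory.

Section quasihyperbolic_metric.
Context {R : realType} {T S : metricType R} (iota : T -> S) (c : R).
Hypothesis iota_isom : forall x y, mdist (iota x) (iota y) = mdist x y.
Hypothesis boundary_neq0 : metric_boundary iota !=set0.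
Hypothesis f_gt0 : forall x, 0 < boundary_dist iota x.
Hypothesis qcT : quasiconvex T c.
Local Notation f := (boundary_dist iota).
Local Notation k := (quasihyperbolic iota).
Local Notation rho := (fun z => (boundary_dist iota z)^-1).
Local Notation joining x y := [set g : R -> T |
  [/\ is_curve g, rectifiable g, g 0 = x & g 1 = y]].

Let rho_ge0 x : 0 <= rho x.
Proof. by rewrite invr_ge0 ltW. Qed.

Lemma continuous_boundary_dist_inv : continuous rho.
Proof.
move=> x; apply: cvgV; first by rewrite gt_eqF.
apply/cvgrPdist_lt => e e0; apply/nbhs_ballP; exists e => //= y.
rewrite ballEmdist /= => xy; apply: le_lt_trans xy.
rewrite ler_norml; have := boundary_dist_lip iota_isom boundary_neq0 x y.
have := boundary_dist_lip iota_isom boundary_neq0 y x.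
by rewrite (metric_sym y x); lra.
Qed.

Lemma joining_neq0 x y : joining x y !=set0.
Proof.
have [g [cg g0 g1 lg]] := qcT x y; exists g; split => //.
by apply: le_lt_trans lg _; rewrite ltry.
Qed.

(** Quasiconvexity provides a rectifiable joining curve, along which the continuous density has a
    finite integral, so [fine] in the definition of the metric discards nothing. *)
Lemma quasihyperbolic_fin x y :
  ereal_inf [set line_integral rho g | g in joining x y] =
  (quasihyperbolic iota x y)%:E.
Proof.
rewrite /quasihyperbolic fineK // ge0_fin_numE; last first.
  by apply: le_ereal_inf_tmp => _ [g _ <-]; exact: line_integral_ge0.
have [g jg] := joining_neq0 x y; have [cg rg _ _] := jg.
apply: le_lt_trans (line_integral_lty continuous_boundary_dist_inv cg rg).
by apply: ereal_inf_lbound; exists g.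
Qed.

Lemma quasihyperbolic_ge0 x y : 0 <= k x y.
Proof.
rewrite -lee_fin -quasihyperbolic_fin.
by apply: le_ereal_inf_tmp => _ [g _ <-]; exact: line_integral_ge0.
Qed.

Lemma quasihyperbolicxx x : k x x = 0.
Proof.
apply/le_anti; rewrite quasihyperbolic_ge0 andbT -lee_fin -quasihyperbolic_fin.
apply: ereal_inf_lbound; exists (cst x); last exact: line_integral_cst.
split => //; first by apply: continuous_subspaceT => ?; exact: cvg_cst.
rewrite /rectifiable curve_lengthE; apply: le_lt_trans (ltry 0).
apply: ge_ereal_sup => _ [s _ <-]; rewrite lee_fin.
suff z a : chain_length (cst x) a s = 0 :> R by rewrite z.
by elim: s a => //= y s ih a; rewrite ih mdistxx addr0.
Qed.

Lemma quasihyperbolic_sym x y : k x y = k y x.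
Proof.
rewrite /quasihyperbolic; congr (fine (ereal_inf _)).
have half u v : [set line_integral rho g | g in joining u v] `<=`
    [set line_integral rho g | g in joining v u].
  move=> _ [g [cg rg g0 g1] <-]; exists (reverse g).
    split; [exact: is_curve_reverse|exact: rectifiable_reverse|..].
      by rewrite /reverse subr0.
    by rewrite /reverse subrr.
  by rewrite line_integral_reverse //; exact: continuous_boundary_dist_inv.
by apply/seteqP; split; exact: half.
Qed.

(** In arc length from [x] the distance to the boundary is at most [f x + s], and a curve to [y] is
    at least as long as the distance; the integral of [1 / (f x + s)] is the logarithm. *)
Lemma quasihyperbolic_ge_ln x y : ln (1 + mdist x y / f x) <= k x y.
Proof.
rewrite -lee_fin -quasihyperbolic_fin.
apply: le_ereal_inf_tmp => _ [g [cg rg g0 g1] <-].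
have [xy|xy] := eqVneq (mdist x y) 0.
  by rewrite xy mul0r addr0 ln1; exact: line_integral_ge0.
have {xy} d0 : 0 < mdist x y by rewrite lt_neqAle eq_sym xy mdist_ge0.
have dL : mdist x y <= length_upto g 1.
  by have := length_upto_dist rg (lexx 0) ler01 (lexx 1);
    rewrite length_upto0 subr0 g0 g1.
have fx := f_gt0 x.
have L0 : 0 < length_upto g 1 by exact: lt_le_trans dL.
apply: le_trans (_ : (ln (f x + length_upto g 1) - ln (f x))%:E <= _)%E.
  rewrite lee_fin -ln_div ?posrE ?addr_gt0 // ler_ln ?posrE.
  - by rewrite mulrDl divff ?gt_eqF // lerD2l ler_pM2r ?invr_gt0.
  - by rewrite addr_gt0 // divr_gt0.
  - by rewrite divr_gt0 // addr_gt0.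
rewrite -integral_shifted_inv // line_integralE.
apply: ge0_le_integral => //.
- move=> s /=; rewrite in_itv /= => sL; rewrite lee_fin invr_ge0; lra.
- apply/measurable_EFinP; apply: subspace_continuous_measurable_fun => //.
  exact: continuous_shifted_inv.
- apply/measurable_EFinP; apply: subspace_continuous_measurable_fun => //.
  exact: (@continuous_arclength_comp _ _ rho g continuous_boundary_dist_inv cg rg).
move=> s /=; rewrite in_itv /= => sL; rewrite lee_fin lef_pV2 ?posrE //; last lra.
have [t t01 <-] := length_upto_surj cg rg sL.
rewrite arclength_param_upto //.
have := boundary_dist_lip iota_isom boundary_neq0 (g t) x.
have /andP[t0 t1] := t01; have := length_upto_dist rg (lexx 0) t0 t1.
by rewrite length_upto0 g0 metric_sym; lra.
Qed.

Lemma quasihyperbolic_dist x y : mdist x y <= f x * (expR (k x y) - 1).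
Proof.
have fx := f_gt0 x; have d0 := mdist_ge0 x y.
have h := quasihyperbolic_ge_ln x y.
rewrite mulrC -ler_pdivrMr // lerBrDl.
rewrite -[leLHS]lnK ?ler_expR // posrE.
by apply: ltr_wpDr => //; rewrite divr_ge0 // ltW.
Qed.

Lemma quasihyperbolic_boundary_dist x y : f y <= f x * expR (k x y).
Proof.
have := quasihyperbolic_dist x y.
have := boundary_dist_lip iota_isom boundary_neq0 y x.
by rewrite metric_sym; lra.
Qed.

End quasihyperbolic_metric.

(** * Gromov hyperbolicity *)

Section gromov_product_theory.
Context {R : realType} {T : Type} (k : T -> T -> R) (delta : R).
Hypothesis kxx : forall x, k x x = 0.
Hypothesis k_sym : forall x y, k x y = k y x.
Hypothesis k_delta : gromov_delta k delta.
Local Notation gp := (gromov_product k).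

(* The four-point condition at w = z is already a triangle inequality up to an
   additive constant. *)
Lemma rough_triangle x y z : k x y <= k x z + k z y + 2 * delta.
Proof.
have := k_delta x y z z; rewrite /gromov_product (k_sym z y) !kxx.
by rewrite addr0 subrr mul0r add0r subrr mul0r minxx; lra.
Qed.

Lemma gromov_productC w x y : gp w x y = gp w y x.
Proof. by rewrite /gromov_product (k_sym x y) (addrC (k x w)). Qed.

Lemma gromov_product_le w x y : gp w x y <= k x w + delta.
Proof.
rewrite /gromov_product; have := rough_triangle y w x.
by rewrite (k_sym y x); lra.
Qed.

Lemma gromov_product_lip w x y z : gp w x y <= gp w z y + k x z + 2 * delta.
Proof.
rewrite /gromov_product; have := rough_triangle x w z.
by have := rough_triangle z y x; rewrite (k_sym z x); lra.
Qed.

Lemma gromov_product_base w v x y : gp w x y <= gp v x y + k w v + 2 * delta.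
Proof.
rewrite /gromov_product; have := rough_triangle x w v.
by have := rough_triangle y w v; rewrite (k_sym v w); lra.
Qed.

End gromov_product_theory.

(** * Combinatorics of two sequences of weights and their tails *)

Lemma nat_ge {R : realType} (x : R) : exists n : nat, x <= n%:R.
Proof.
by exists (Num.truncn x).+1; apply/ltW/truncnS_gt.
Qed.

(** Walk through the grid from [(n, m)]: at [(i, j)] advance [i] if [a i] is the bounded term, and
    [j] otherwise. Every move raises [i + j] by one, so no [th] is charged twice, and the walk stops
    when one of the sequences is exhausted. *)
Lemma staircase {R : realType} (a b th : nat -> R) n n' m m' :
  (n <= n')%N -> (m <= m')%N -> (forall j, 0 <= th j) ->
  (forall i j, (n <= i < n')%N -> (m <= j < m')%N ->
     Num.min (a i) (b j) <= th (i + j)%N) ->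
  \sum_(n <= i < n') a i <= \sum_(n + m <= j < n' + m') th j \/
  \sum_(m <= j < m') b j <= \sum_(n + m <= j < n' + m') th j.
Proof.
move=> + + th0; move: {2}((n' - n) + (m' - m))%N (leqnn ((n' - n) + (m' - m))) => s.
elim: s n m => [|s ih] n m hs nn mm h.
  by left; rewrite big_geq ?sumr_ge0 //; lia.
have [nn'|nn'] := leqP n' n; first by left; rewrite big_geq ?sumr_ge0.
have [mm'|mm'] := leqP m' m; first by right; rewrite big_geq ?sumr_ge0.
have lt : (n + m < n' + m')%N by lia.
have := h n m; rewrite !leqnn nn' mm' => /(_ isT isT); rewrite ge_min => /orP[ha|hb].
  have [||||H|H] := ih n.+1 m; [lia|lia|lia| |left|right].
    by move=> i j hi hj; apply: h; lia.
    by rewrite big_ltn // [leRHS]big_ltn // lerD // -addSn.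
  by apply: le_trans H _; rewrite [leRHS]big_ltn // addSn lerDr.
have [||||H|H] := ih n m.+1; [lia|lia|lia| |left|right].
  by move=> i j hi hj; apply: h; lia.
  by apply: le_trans H _; rewrite [leRHS]big_ltn // addnS lerDr.
by rewrite big_ltn // [leRHS]big_ltn // lerD // -addnS.
Qed.

(** A discrete intermediate value: one step divides the sequence by at most [lam], so the first
    value not above [l] is still at least [l / lam]. *)
Lemma first_below {R : realType} (A : nat -> R) (lam l : R) n0 N :
  (n0 <= N)%N -> A N <= l -> l <= A n0 -> 1 <= lam -> 0 <= A n0 ->
  (forall n, (n0 <= n < N)%N -> A n <= lam * A n.+1) ->
  exists n, [/\ (n0 <= n <= N)%N, A n <= l & l <= lam * A n].
Proof.
move=> + ANl + lam1 + hA; move: {2}(N - n0)%N (leqnn (N - n0)) hA => s.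
elim: s n0 => [|s ih] n0 hs hA n0N lA A0.
  have E : n0 = N by lia.
  exists n0; split; [lia|by rewrite E|].
  by apply: le_trans lA _; rewrite ler_peMl.
have [Al|lA'] := leP (A n0) l.
  exists n0; split; [lia|by []|].
  by apply: le_trans lA _; rewrite ler_peMl.
have n0N' : (n0 < N)%N.
  rewrite ltn_neqAle n0N andbT; apply/eqP => E.
  by move: lA'; rewrite E ltNge ANl.
have [lA1|A1l] := leP l (A n0.+1).
  have A1 : 0 <= A n0.+1.
    have := hA n0; rewrite leqnn n0N' => /(_ isT) H.
    have : 0 <= lam * A n0.+1 by exact: le_trans H.
    by rewrite pmulr_rge0 // (lt_le_trans _ lam1).
  have [|i hi|n [hn h1 h2]] := ih n0.+1 _ _ n0N' lA1 A1; [lia|apply: hA; lia|].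
  by exists n; split => //; lia.
exists n0.+1; split; [lia|exact: ltW|].
by apply: le_trans lA _; apply: hA; lia.
Qed.

Section two_tails.
Context {R : realType}.
Variables (a b phi : nat -> R) (N1 N2 n0 : nat) (r l lam C1 S : R).
(** The summand [r] makes the tails end at [r > 0] instead of 0, so that a bounded ratio of
    consecutive tails is possible up to the last index. *)
Let A n := r + \sum_(n <= i < N1) a i.
Let B n := r + \sum_(n <= i < N2) b i.
Hypotheses (a0 : forall i, 0 <= a i) (b0 : forall i, 0 <= b i).
Hypotheses (phi0 : forall i, 0 <= phi i) (r0 : 0 < r) (l0 : 0 < l).
Hypotheses (lam1 : 1 <= lam) (C10 : 0 < C1).
Hypothesis hA : forall n, (n0 <= n < N1)%N -> A n <= lam * A n.+1.
Hypothesis hB : forall n, (n0 <= n < N2)%N -> B n <= lam * B n.+1.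
Hypothesis key : forall i j, (n0 <= i < N1)%N -> (n0 <= j < N2)%N ->
  Num.min (a i) (b j) <= C1 * (A i + B j) * phi (i + j)%N.
Hypothesis phiS : forall u v, (n0 + n0 <= u)%N -> \sum_(u <= j < v) phi j <= S.
Hypotheses (n0N1 : (n0 <= N1)%N) (n0N2 : (n0 <= N2)%N).
Hypotheses (lA : l <= A n0) (lB : l <= B n0).

Let A_ge0 n : 0 <= A n.
Proof. by rewrite addr_ge0 ?sumr_ge0 // ltW. Qed.

Let B_ge0 n : 0 <= B n.
Proof. by rewrite addr_ge0 ?sumr_ge0 // ltW. Qed.

Let A_split n n' : (n <= n' <= N1)%N -> \sum_(n <= i < n') a i = A n - A n'.
Proof.
by move=> /andP[nn' n'N]; rewrite /A (big_cat_nat nn' n'N) /=; ring.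
Qed.

Let B_split n n' : (n <= n' <= N2)%N -> \sum_(n <= i < n') b i = B n - B n'.
Proof.
by move=> /andP[nn' n'N]; rewrite /B (big_cat_nat nn' n'N) /=; ring.
Qed.

(** Between consecutive scales both tails lose a definite amount. The staircase charges the loss of
    one of them to a new block of the series of [phi], and the sum over this block is at least
    [1 / (4 * lam * C1)]. *)
Let scales p : r <= l / (2 * lam) ^+ p -> exists n m,
  [/\ (n0 <= n <= N1)%N, (n0 <= m <= N2)%N,
      A n <= l / (2 * lam) ^+ p <= lam * A n,
      B m <= l / (2 * lam) ^+ p <= lam * B m &
      p%:R <= 4 * lam * C1 * \sum_(n0 + n0 <= j < n + m) phi j].
Proof.
have lam0 : 0 < lam by exact: lt_le_trans lam1.
have lam2 : 1 <= 2 * lam by move: lam1; lra.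
have AN : A N1 = r by rewrite /A big_geq // addr0.
have BN : B N2 = r by rewrite /B big_geq // addr0.
elim: p => [|p ih] rl.
  rewrite expr0 divr1 in rl *.
  have [||n [hn n1 n2]] := first_below n0N1 _ lA lam1 _ hA; rewrite ?AN //.
  have [||m [hm m1 m2]] := first_below n0N2 _ lB lam1 _ hB; rewrite ?BN //.
  exists n, m; split; rewrite ?n1 ?m1 //.
  by rewrite mulr_ge0 ?sumr_ge0 // !mulr_ge0 // ltW.
set l' := l / (2 * lam) ^+ p in ih.
have l'0 : 0 < l' by rewrite divr_gt0 // exprn_gt0 // mulr_gt0.
have El : l / (2 * lam) ^+ p.+1 = l' / (2 * lam).
  by rewrite exprS invfM mulrCA mulrA (mulrC l') /l' ; ring.
rewrite El in rl *.
have ll' : l' / (2 * lam) <= l'.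
  by rewrite ler_pdivrMr ?mulr_gt0 // ler_peMr ?(ltW l'0).
have [n [m [/andP[n0n nN] /andP[m0m mN] /andP[n1 n2] /andP[m1 m2] hp]]] :=
  ih (le_trans rl ll').
(* At [n] the tail may already be as small as [l' / lam]. The factor 2 in the next scale leaves a
   loss of at least [l' / (2 * lam)]. *)
have half : l' / (2 * lam) <= l' / lam.
  by rewrite ler_pM2l // lef_pV2 ?posrE ?mulr_gt0 //; lra.
have lA' : l' / lam <= A n by rewrite ler_pdivrMr // mulrC.
have lB' : l' / lam <= B m by rewrite ler_pdivrMr // mulrC.
have hA' i : (n <= i < N1)%N -> A i <= lam * A i.+1.
  by move=> hi; apply: hA; clear -n0n hi; lia.
have hB' i : (m <= i < N2)%N -> B i <= lam * B i.+1.
  by move=> hi; apply: hB; clear -m0m hi; lia.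
have [n' [/andP[nn' n'N] n1' n2']] : exists n', [/\ (n <= n' <= N1)%N,
    A n' <= l' / (2 * lam) & l' / (2 * lam) <= lam * A n'].
  by apply: first_below => //; rewrite ?AN //; exact: le_trans half lA'.
have [m' [/andP[mm' m'N] m1' m2']] : exists m', [/\ (m <= m' <= N2)%N,
    B m' <= l' / (2 * lam) & l' / (2 * lam) <= lam * B m'].
  by apply: first_below => //; rewrite ?BN //; exact: le_trans half lB'.
exists n', m'; split; rewrite ?n1' ?m1' ?n'N ?m'N ?(leq_trans n0n nn')
  ?(leq_trans m0m mm') //.
have Ai i : (n <= i < N1)%N -> A i <= l'.
  move=> /andP[ni /ltnW iN]; apply: le_trans n1.
  by rewrite -subr_ge0 -A_split ?sumr_ge0 ?ni.
have Bi i : (m <= i < N2)%N -> B i <= l'.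
  move=> /andP[ni /ltnW iN]; apply: le_trans m1.
  by rewrite -subr_ge0 -B_split ?sumr_ge0 ?ni.
have hth i j : (n <= i < n')%N -> (m <= j < m')%N ->
    Num.min (a i) (b j) <= 2 * C1 * l' * phi (i + j)%N.
  move=> /andP[ni ni'] /andP[mj mj'].
  have iN := leq_trans ni' n'N; have jN := leq_trans mj' m'N.
  apply: le_trans (key _ _) _; rewrite ?(leq_trans n0n ni) ?(leq_trans m0m mj) //.
  apply: ler_wpM2r => //.
  have Ai' : A i <= l' by apply: Ai; rewrite ni.
  have Bj' : B j <= l' by apply: Bi; rewrite mj.
  have : C1 * (A i + B j) <= C1 * (l' + l') by rewrite ler_pM2l // lerD.
  lra.
have th0 j : 0 <= 2 * C1 * l' * phi j.
  apply: mulr_ge0 (phi0 j); apply: mulr_ge0 (ltW l'0).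
  by rewrite mulr_ge0 // ltW.
have sums : l' / (2 * lam) <=
    \sum_(n + m <= j < n' + m') 2 * C1 * l' * phi j.
  have two : l' / lam = l' / (2 * lam) + l' / (2 * lam) by field; rewrite gt_eqF.
  have [H|H] := staircase nn' mm' th0 hth; apply: le_trans H.
    by rewrite A_split ?nn' //; lra.
  by rewrite B_split ?mm' //; lra.
have step : 1 <= 4 * lam * C1 * \sum_(n + m <= j < n' + m') phi j.
  rewrite -mulr_sumr in sums.
  have e : l' * 1 <= l' * (4 * lam * C1 * \sum_(n + m <= j < n' + m') phi j).
    rewrite ler_pdivrMr ?mulr_gt0 // in sums; lra.
  by rewrite ler_pM2l in e.
rewrite (@big_cat_nat _ _ _ (n + m)%N) /= ?leq_add //.
by rewrite mulrDr -natr1 lerD.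
Qed.

Lemma two_tails p : r <= l / (2 * lam) ^+ p -> p%:R <= 4 * lam * C1 * S.
Proof.
move=> /scales[n [m [_ _ _ _ h]]]; apply: le_trans h _.
by rewrite ler_pM2l ?mulr_gt0 ?phiS // (lt_le_trans _ lam1).
Qed.

End two_tails.

(* [q] is a quasimetric and [F] a weight on the hyperbolic space [(T, k)]; they
   stand for the distance and the distance to the boundary, or for their
   sphericalizations. *)
Section uniform_weight.
Context {R : realType} {T : Type}.
Variables (k q : T -> T -> R) (F : T -> R) (E psi : R -> R).
Variables (delta L D t0 K S : R) (w0 : T).
Hypothesis kxx : forall x, k x x = 0.
Hypothesis k_ge0 : forall x y, 0 <= k x y.
Hypothesis k_sym : forall x y, k x y = k y x.
Hypothesis delta0 : 0 <= delta.
Hypothesis k_delta : gromov_delta k delta.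
Hypothesis L1 : 1 <= L.
Hypothesis q_ge0 : forall x y, 0 <= q x y.
Hypothesis q_sym : forall x y, q x y = q y x.
Hypothesis q_chain : forall (p : nat -> T) n,
  q (p 0) (p n) <= L * \sum_(0 <= i < n) q (p i) (p i.+1).
Hypothesis F_gt0 : forall x, 0 < F x.
Hypothesis E_homo : forall s t, s <= t -> E s <= E t.
Hypothesis qE : forall x y, q x y <= F x * E (k x y).
Hypothesis FE : forall x y, F y <= F x * E (k x y).
Hypothesis q_uniform : forall x y, t0 <= k x y ->
  psi (k x y) * Num.min (F x) (F y) <= 2 * q x y.
Hypothesis qD : forall x y, q x y <= D.
Hypothesis psi_homo : forall s t, 1 <= s -> s <= t -> psi s <= psi t.
Hypothesis psi_gt0 : forall s, 1 <= s -> 0 < psi s.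
Hypothesis psi_ge0 : forall s, 0 <= s -> 0 <= psi s.
Hypothesis psi_sum : forall n, \sum_(1 <= i < n) (psi i%:R)^-1 <= S.
Hypothesis K0 : 0 <= K.

(** Rays are sampled at integer times: with unit steps, estimates along a ray become sums over the
    series of [1 / psi]. *)
Definition integer_ray (g : nat -> T) : Prop :=
  g 0 = w0 /\ forall i j, k (g i) (g j) = `|i%:R - j%:R|.

Hypothesis rays : forall x, exists g N, integer_ray g /\ k x (g N) <= K.

Local Notation gp := (gromov_product k w0).
Local Notation tail n N := (\sum_(n <= i < N) (psi i%:R)^-1).

Let E_ge1 t : 0 <= t -> 1 <= E t.
Proof.
move=> t_ge0; apply: le_trans (E_homo t_ge0).
by have := FE w0 w0; rewrite kxx ler_pMr ?F_gt0.
Qed.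

Let E_gt0 t : 0 <= t -> 0 < E t.
Proof. by move=> /E_ge1; apply: lt_le_trans. Qed.

Let ipsi_ge0 i : (0 < i)%N -> 0 <= (psi i%:R)^-1.
Proof. by move=> i0; rewrite invr_ge0 ltW // psi_gt0 // ler1n. Qed.

Let tail_ge0 a b : (0 < a)%N -> 0 <= tail a b.
Proof.
by move=> a0; rewrite big_nat sumr_ge0 // => i hi; apply: ipsi_ge0; lia.
Qed.

Let D0 : 0 <= D.
Proof. exact: le_trans (q_ge0 w0 w0) (qD w0 w0). Qed.

Let q4 x y z u : q x u <= L * (q x y + q y z + q z u).
Proof.
have := q_chain (fun i => match i with 0 => x | 1 => y | 2 => z | _ => u end) 3.
by rewrite /= !big_nat_recl //= big_nil addr0 addrA.
Qed.

Let psi_tail_le a b : (0 < a)%N -> tail a b <= S.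
Proof.
move=> a0; have [ba|/ltnW ab] := leqP b a.
  by rewrite big_geq //; have := psi_sum 0; rewrite big_geq.
apply: le_trans (psi_sum b).
by rewrite [leRHS](@big_cat_nat _ _ _ a) //= lerDr tail_ge0.
Qed.

Lemma psi_tail_small (e : R) : 0 < e ->
  exists2 n0, (0 < n0)%N & forall n N, (n0 <= n)%N -> tail n N <= e.
Proof.
move=> e0; pose A := range (fun n => tail 1 n).
have hA : has_sup A.
  by split; [exists (tail 1 0), 0%N|exists S => _ [n _ <-]; exact: psi_sum].
have [_ [n1 _ <-] hn1] := sup_adherent e0 hA.
exists (maxn 1 n1); first by rewrite leq_max.
move=> n N hn; have [Nn|nN] := leqP N n; first by rewrite big_geq // ltW.
have hn1' : tail 1 n1 <= tail 1 n.
  have [n11|n11] := leqP n1 1; first by rewrite big_geq ?tail_ge0.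
  by rewrite [leRHS](@big_cat_nat _ _ _ n1) ?lerDl ?tail_ge0 //=; lia.
have sN : tail 1 N <= sup A by apply: ub_le_sup; [case: hA|exists N].
rewrite (@big_cat_nat _ _ _ n) /= in sN; [|lia|lia].
lra.
Qed.

Lemma psi_inv_small (e : R) : 0 < e ->
  exists2 n0, (0 < n0)%N & forall n, (n0 <= n)%N -> (psi n%:R)^-1 <= e.
Proof.
move=> /psi_tail_small[n0 n00 h]; exists n0 => // n nn.
by have := h n n.+1 nn; rewrite big_nat1.
Qed.

(** Uniformity between [x] and [w0] bounds the smaller of the two weights by [2 * D / psi n]. For
    large [n] this is below the fixed weight of [w0], so the bound concerns [x]. *)
Lemma weight_decay : exists2 n1, (0 < n1)%N & forall n x, (n1 <= n)%N ->
  n%:R <= k x w0 -> F x <= 2 * D * (psi n%:R)^-1.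
Proof.
have [n0 t0n] := nat_ge t0.
(* With [2 * D + 1] in place of [2 * D], the bound is strictly below [F w0], also when [D = 0]. *)
have e0 : 0 < F w0 / (2 * D + 1) by rewrite divr_gt0 //; have := D0; lra.
have [n1 n10 h] := psi_inv_small e0.
exists (maxn n1 n0); first by rewrite leq_max n10.
move=> n x; rewrite geq_max => /andP[n1n n0n] nk.
have n_ge1 : (1:R) <= n%:R by rewrite ler1n; lia.
have pn := psi_gt0 n_ge1.
have pk : psi n%:R <= psi (k x w0) by exact: psi_homo.
have tk : t0 <= k x w0 by apply: le_trans t0n (le_trans _ nk); rewrite ler_nat.
have m0 : 0 <= Num.min (F x) (F w0) by rewrite le_min !ltW.
have : Num.min (F x) (F w0) <= 2 * D * (psi n%:R)^-1.
  rewrite ler_pdivlMr // mulrC; apply: le_trans (ler_wpM2r m0 pk) _.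
  apply: le_trans (q_uniform tk) _; rewrite ler_pM2l //.
rewrite ge_min => /orP[//|].
have := h n n1n; rewrite ler_pdivlMr; last by have := D0; lra.
have := D0; have := ipsi_ge0 (leq_trans n10 n1n).
set u := (psi _)^-1 => u0 D0' h1 h2.
have : 0 < u by rewrite invr_gt0.
lra.
Qed.

Lemma weight_small (e : R) : 0 < e -> exists M, forall x, M <= k x w0 -> F x <= e.
Proof.
move=> e0; have [n1 n10 h] := weight_decay.
have [|n2 n20 h2] := @psi_inv_small (e / (2 * D + 1)).
  by rewrite divr_gt0 //; have := D0; lra.
exists (maxn n1 n2)%:R => x xk; apply: le_trans (h _ _ (leq_maxl _ _) xk) _.
have := h2 _ (leq_maxr n1 n2); have := @ipsi_ge0 (maxn n1 n2).
set u := (psi _)^-1 => /(_ _) u0; rewrite ler_pdivlMr; last by have := D0; lra.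
have := u0 (leq_trans n10 (leq_maxl _ _)); lra.
Qed.

Section ray_facts.
Variables (g : nat -> T) (x : T) (N : nat).
Hypotheses (gr : integer_ray g) (xN : k x (g N) <= K).

Let k0g i : k (g i) w0 = i%:R.
Proof.
by have [<- ->] := gr; rewrite subr0 ger0_norm.
Qed.

Lemma ray_gromov_product n : (n <= N)%N -> gp (g n) (g N) = n%:R.
Proof.
move=> nN; rewrite /gromov_product !k0g; have [_ ->] := gr.
by rewrite ler0_norm ?subr_le0 ?ler_nat //; lra.
Qed.

Lemma ray_index_ge : k x w0 - K - 2 * delta <= N%:R.
Proof.
have := rough_triangle kxx k_sym k_delta x w0 (g N); rewrite k0g.
move: xN; lra.
Qed.

Lemma ray_step i : q (g i) (g i.+1) <= F (g i) * E 1.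
Proof.
have [_ h] := gr; have := qE (g i) (g i.+1).
by rewrite h -natr1 opprD addNKr normrN1.
Qed.

(** The chain follows the sample points and ends with one jump from [g N] to [x], of size at most
    [K] in [k]. *)
Lemma ray_chain n : (n <= N)%N ->
  q (g n) x <= L * (\sum_(n <= i < N) F (g i) * E 1 + F (g N) * E K).
Proof.
move=> nN; pose p i := if (i <= N - n)%N then g (n + i)%N else x.
have := q_chain p (N - n).+1; rewrite {1 2}/p addn0 leq0n ltnn.
move=> /le_trans; apply; rewrite ler_pM2l ?(lt_le_trans _ L1) //.
rewrite big_nat_recr //= lerD //.
  rewrite -{2}(add0n n) big_addn ler_sum_nat // => i hi.
  rewrite /p ifT; last lia.
  by rewrite ifT; [rewrite addnS addnC; exact: ray_step|lia].
rewrite /p leqnn ltnn subnKC //; apply: le_trans (qE _ _) _.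
by rewrite ler_pM2l // E_homo // k_sym.
Qed.

End ray_facts.

(** A large product puts the rays towards [x] and [y] within [4 * delta] of each other at a fixed
    time [n]. The chain [x], [g n], [h n], [y] is then short: its outer legs are controlled by tails
    of the series, its middle step by the weight at time [n]. *)
Lemma quasimetric_small_of_product (e : R) : 0 < e ->
  exists M, forall x y, M <= gp x y -> q x y <= e.
Proof.
move=> e0; have [n1 n10 decay] := weight_decay.
have L0 : 0 < L by exact: lt_le_trans L1.
pose G := 2 * D * (E 1 + E K) ; pose H := 2 * D * E (4 * delta).
have d4 : 0 <= 4 * delta by have := delta0; lra.
have G0 : 0 <= G.
  rewrite mulr_ge0 ?addr_ge0 ?(ltW (E_gt0 _)) //; have := D0; lra.
have H0 : 0 <= H.
  rewrite mulr_ge0 ?(ltW (E_gt0 _)) //; have := D0; lra.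
pose Z := L * (L * G + H + L * G) + 1.
have Z0 : 0 < Z.
  have LG : 0 <= L * G by rewrite pmulr_rge0.
  by rewrite ltr_wpDl // pmulr_rge0 // addr_ge0 // addr_ge0.
have [n2 n20 hn2] := psi_tail_small (divr_gt0 e0 Z0).
pose n := maxn n1 n2.
have n0 : (0 < n)%N by rewrite leq_max n10.
have tailn N : tail n N <= e / Z by apply: hn2; rewrite leq_maxr.
have leg x g N : integer_ray g -> k x (g N) <= K -> (n <= N)%N ->
    q (g n) x <= L * G * (e / Z).
  move=> gr xN nN; apply: le_trans (ray_chain gr xN nN) _.
  rewrite -mulrA ler_pM2l //.
  (* The final jump is charged to the term of index [N], hence the tail up to [N.+1]. *)
  apply: le_trans (_ : _ <= G * tail n N.+1) _; last exact: ler_wpM2l.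
  have Fi i : (n <= i)%N -> F (g i) <= 2 * D * (psi i%:R)^-1.
    move=> ni; apply: decay; first exact: leq_trans (leq_maxl _ _) ni.
    by have [g0 gk] := gr; rewrite -g0 gk subr0 ger0_norm.
  have DE : 0 <= 2 * D by have := D0; lra.
  rewrite big_nat_recr //= /G.
  have a1 : \sum_(n <= i < N) F (g i) * E 1 <= 2 * D * E 1 * tail n N.
    rewrite mulr_sumr ler_sum_nat // => i /andP[ni _].
    by rewrite mulrAC ler_wpM2r ?Fi // ltW // E_gt0.
  have a2 : F (g N) * E K <= 2 * D * E K * (psi N%:R)^-1.
    by rewrite mulrAC ler_wpM2r ?Fi // ltW // E_gt0.
  have t_ge0 : 0 <= tail n N := tail_ge0 N n0.
  have a3 : 0 <= 2 * D * E K * tail n N by rewrite !mulr_ge0 // ltW // E_gt0.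
  have a4 : 0 <= 2 * D * E 1 * (psi N%:R)^-1.
    by rewrite mulr_ge0 ?ipsi_ge0 ?(leq_trans n0 nN) // mulr_ge0 // ltW // E_gt0.
  by move: a1 a2 a3 a4; lra.
(* Replacing [x] by [g N1] and [y] by [h N2] costs [K + 2 * delta] in the product each time. *)
exists (n%:R + 2 * K + 4 * delta) => x y xyM.
have [g [N1 [gr xN]]] := rays x; have [h [N2 [hr yN]]] := rays y.
have lx := gromov_product_le kxx k_sym k_delta w0 x y.
have ly := gromov_product_le kxx k_sym k_delta w0 y x.
rewrite (gromov_productC k_sym) in ly.
have nN1 : (n <= N1)%N.
  rewrite -(ler_nat R); have := ray_index_ge gr xN.
  by move: delta0 K0 xyM lx; lra.
have nN2 : (n <= N2)%N.
  rewrite -(ler_nat R); have := ray_index_ge hr yN.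
  by move: delta0 K0 xyM ly; lra.
have gn := ray_gromov_product gr nN1; have hn := ray_gromov_product hr nN2.
have mid : n%:R <= gp (g N1) (h N2).
  have := gromov_product_lip kxx k_sym k_delta w0 x y (g N1).
  have := gromov_product_lip kxx k_sym k_delta w0 y (g N1) (h N2).
  rewrite !(gromov_productC k_sym _ _ (g N1)).
  by move: xN yN xyM K0 delta0; lra.
(* Two uses of the four-point condition carry the product from the ends of the rays back to time
   [n], each losing [delta]. *)
have c1 := k_delta (g N1) (h n) (h N2) w0.
rewrite (gromov_productC k_sym w0 (h N2) (h n)) hn (min_idPr mid) in c1.
have c2 := k_delta (g n) (h n) (g N1) w0.
rewrite gn in c2.
have c3 : n%:R - 2 * delta <= gp (g n) (h n).
  apply: le_trans c2; rewrite lerBrDr le_min.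
  by move: c1 delta0; lra.
have kn : k (g n) (h n) <= 4 * delta.
  move: c3; rewrite /gromov_product.
  have [g0 gk] := gr; have [h0 hk] := hr.
  rewrite -{1}g0 gk -h0 hk subr0 ger0_norm //; lra.
have qm : q (g n) (h n) <= H * (e / Z).
  apply: le_trans (qE _ _) _.
  apply: le_trans (_ : _ <= 2 * D * (psi n%:R)^-1 * E (4 * delta)) _.
    apply: ler_pM; rewrite ?(ltW (F_gt0 _)) ?(ltW (E_gt0 _)) ?E_homo //.
    apply: decay; first exact: leq_maxl.
    by have [g0 gk] := gr; rewrite -g0 gk subr0 ger0_norm.
  rewrite mulrAC; apply: ler_wpM2l => //.
  by have := tailn n.+1; rewrite big_nat1.
have q1 := leg _ _ _ gr xN nN1; have q2 := leg _ _ _ hr yN nN2.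
apply: le_trans (q4 x (g n) (h n) y) _; rewrite (q_sym x).
apply: le_trans (_ : _ <= (Z - 1) * (e / Z)) _.
  rewrite /Z addrK -mulrA ler_pM2l // !mulrDl; lra.
have -> : (Z - 1) * (e / Z) = e - e / Z by field; rewrite gt_eqF.
by rewrite gerBl divr_ge0 // ltW.
Qed.

(* If the product stays bounded, the rays towards x and y diverge, so psi of
   the distance between points on them bounds the smaller weight from above
   along both rays, and [two_tails] prevents the remaining tails from becoming
   small. *)
Lemma product_large_of_small (M : R) : exists2 r, 0 < r & forall x y,
  F x <= r -> F y <= r -> q x y <= r -> M <= gp x y.
Proof.
have L0 : 0 < L by exact: lt_le_trans L1.
(* Bounds the product of points on the two rays from time [n0] on: [2 * K + 4 * delta] for leaving
   [x] and [y], and [2 * delta] for two uses of the four-point condition. *)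
pose M' := M + 2 * K + 6 * delta.
(* Points at times [i] and [j] will be at distance at least [i + j - C]; from time [n0] on this is
   at least 1 and at least [t0]. *)
have [C hC] := nat_ge (2 * M'); have [n0 hn0] := nat_ge (C%:R + `|t0| + `|M'| + 1).
have [hn1 hn2 hn3] : [/\ C%:R + t0 + 1 <= n0%:R, M' < n0%:R & (C + 1 <= n0)%N].
  have h1 := ler_norm t0; have h2 := ler_norm M'.
  have h3 := normr_ge0 t0; have h4 := normr_ge0 M'.
  have h5 : (0 : R) <= C%:R by [].
  split; [lra|lra|]; rewrite -(ler_nat R) natrD; lra.
have n0_ge0 : (0 : R) <= n0%:R by [].
pose X := n0%:R + K + 2 * delta + 1.
have X0 : 0 <= X by rewrite /X; move: K0 delta0; lra.
(* A lower bound for the weights of both rays at time [n0], independent of [x] and [y]; it is the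
   top scale for the tails. *)
pose l := F w0 / E n0%:R.
have l0 : 0 < l by rewrite divr_gt0 // E_gt0.
have E1 : 1 <= E 1 by exact: E_ge1.
have EK1 : 1 <= E K by exact: E_ge1.
have E11 : 0 <= E 1 by lra.
have EK0 : 0 <= E K by lra.
(* A weight is at most [E 1] times the next one; at the end of the ray the next one is at most
   [r * E K], and the tail there is [r]. *)
pose lam := 1 + E 1 * E K.
have lam1 : 1 <= lam by rewrite /lam lerDl mulr_ge0.
pose G := E 1 + E K * E K.
have G0 : 0 <= G by rewrite addr_ge0 ?mulr_ge0.
(* The 2 comes from [q_uniform], the outer [L] from the chain [g i], [x], [y], [h j], the factor
   [L * G] from its two legs, and the 1 from [q x y <= r], which the tails absorb. *)
pose C1 := 2 * (L * (L * G + 1)).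
have C10 : 0 < C1.
  by rewrite mulr_gt0 // mulr_gt0 // ltr_wpDl // mulr_ge0 // ltW.
(* More scales than the series of [1 / psi] can pay for. *)
have [p hp] := nat_ge (4 * lam * C1 * S + 1).
have lam2 : 0 < (2 * lam) ^+ p by rewrite exprn_gt0 //; lra.
(* The first entry makes room for [p] scales; the second forces [x] and [y] so far from [w0] that
   their rays extend past time [n0]. *)
pose r := Num.min (l / (2 * lam) ^+ p) (F w0 / (2 * E X)).
have EX := E_gt0 X0.
have r0 : 0 < r.
  rewrite lt_min; apply/andP.
  by split; apply: divr_gt0 => //; apply: mulr_gt0.
exists r => // x y Fx Fy qr; rewrite leNgt; apply/negP => gpM.
have far z : F z <= r -> X < k z w0.
  move=> Fz; rewrite ltNge; apply/negP => kX.
  have := FE z w0; apply/negP; rewrite -ltNge.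
  apply: le_lt_trans (_ : r * E X < _).
    by apply: ler_pM; rewrite ?(ltW (F_gt0 _)) ?(ltW (E_gt0 _)) ?E_homo.
  rewrite -ltr_pdivlMr //; apply: le_lt_trans (_ : F w0 / (2 * E X) < _).
    by rewrite ge_min lexx orbT.
  rewrite ltr_pM2l // ltf_pV2 ?posrE ?mulr_gt0 //; lra.
have [g [N1 [gr xN]]] := rays x; have [h [N2 [hr yN]]] := rays y.
have index z f N : F z <= r -> integer_ray f -> k z (f N) <= K -> (n0 < N)%N.
  move=> Fz fr zN; rewrite -(ltr_nat R).
  have := ray_index_ge fr zN; have := far z Fz; rewrite /X; lra.
have n0N1 : (n0 < N1)%N := index _ _ _ Fx gr xN.
have n0N2 : (n0 < N2)%N := index _ _ _ Fy hr yN.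
pose A (f : nat -> T) N n := r + \sum_(n <= i < N) F (f i).
have Fsum_ge0 f N n : 0 <= \sum_(n <= i < N) F (f i).
  by rewrite sumr_ge0 // => i _; rewrite ltW.
have A_ge f N n : r <= A f N n by rewrite /A lerDl.
have ray_weight f i j : integer_ray f -> F (f j) <= F (f i) * E (`|i%:R - j%:R|).
  by move=> [_ <-]; exact: FE.
have end_weight z (f : nat -> T) N : F z <= r -> k z (f N) <= K -> F (f N) <= r * E K.
  move=> Fz zN; apply: le_trans (FE z _) _.
  by apply: ler_pM; rewrite ?(ltW (F_gt0 _)) ?(ltW (E_gt0 _)) ?E_homo.
have A_step z f N n : F z <= r -> integer_ray f -> k z (f N) <= K ->
    (n0 <= n < N)%N -> A f N n <= lam * A f N n.+1.
  move=> Fz fr zN /andP[_ nN]; rewrite {1}/A big_ltn // addrCA -/(A f N n.+1).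
  have An := A_ge f N n.+1.
  have A0 : 0 <= A f N n.+1 by apply: le_trans An; exact: ltW.
  rewrite /lam mulrDl mul1r addrC lerD2l.
  have h1 := ray_weight f n.+1 n fr.
  rewrite -natr1 (addrC n%:R) addrK normr1 in h1.
  apply: le_trans h1 _; rewrite mulrC -mulrA ler_pM2l; last lra.
  have [nN'|nN'] := leqP N n.+1.
    have -> : n.+1 = N by clear -nN nN'; lia.
    apply: le_trans (end_weight _ _ _ Fz zN) _.
    by rewrite mulrC ler_wpM2l.
  apply: le_trans (_ : F (f n.+1) <= A f N n.+1) _.
    by rewrite /A big_ltn // addrCA lerDl addr_ge0 ?Fsum_ge0 ?(ltW r0).
  by rewrite ler_peMl.
have A_start z f N : F z <= r -> integer_ray f -> (n0 < N)%N -> l <= A f N n0.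
  move=> Fz fr nN; apply: le_trans (_ : F (f n0) <= _).
    rewrite /l ler_pdivrMr ?E_gt0 //; have := ray_weight f n0 0 fr.
    by have [-> _] := fr; rewrite subr0 ger0_norm.
  by rewrite /A big_ltn // addrCA lerDl addr_ge0 ?Fsum_ge0 ?(ltW r0).
(* If the product at times [i] and [j] exceeded [M'], the four-point condition would propagate a
   large product along both rays to their ends, where it is bounded. *)
have sep i j : (n0 <= i <= N1)%N -> (n0 <= j <= N2)%N ->
    (i + j - C)%N%:R <= k (g i) (h j).
  move=> hi hj.
  have gi : gp (g i) (g N1) = i%:R by apply: ray_gromov_product => //; clear -hi hj; lia.
  have hj' : gp (h j) (h N2) = j%:R by apply: ray_gromov_product => //; clear -hi hj; lia.
  have ij : n0%:R <= i%:R :> R /\ n0%:R <= j%:R :> R.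
    by rewrite !ler_nat; clear -hi hj; lia.
  have top : gp (g N1) (h N2) < M + 2 * K + 4 * delta.
    have := gromov_product_lip kxx k_sym k_delta w0 (g N1) (h N2) x.
    have := gromov_product_lip kxx k_sym k_delta w0 (h N2) x y.
    rewrite !(gromov_productC k_sym _ _ x) (k_sym (g N1)) (k_sym (h N2)).
    by move: xN yN gpM; lra.
  have c1 := k_delta (g N1) (h N2) (g i) w0.
  rewrite (gromov_productC k_sym w0 (g N1)) gi in c1.
  have c2 := k_delta (g i) (h N2) (h j) w0; rewrite hj' in c2.
  have c3 : gp (g i) (h j) <= M'.
    rewrite leNgt; apply/negP => c3.
    have c4 : M' - delta < gp (g i) (h N2).
      apply: lt_le_trans c2; rewrite ltrD2r lt_min c3 /=; lra.
    have : M' - delta - delta < gp (g N1) (h N2).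
      apply: lt_le_trans c1; rewrite ltrD2r lt_min c4 andbT.
      by move: delta0; lra.
    by move: top; rewrite /M'; move: delta0; lra.
  rewrite natrB; last by clear -hi hj hn3; lia.
  move: c3; rewrite /gromov_product natrD.
  have [g0 gk] := gr; have [h0 hk] := hr.
  rewrite -{1}g0 gk -h0 hk !subr0 !ger0_norm //; lra.
have leg z (f : nat -> T) N i :
    integer_ray f -> k z (f N) <= K -> F z <= r -> (i <= N)%N ->
    q (f i) z <= L * (G * A f N i).
  move=> fr zN Fz iN; apply: le_trans (ray_chain fr zN iN) _.
  rewrite ler_pM2l // -mulr_suml.
  have h1 := end_weight _ _ _ Fz zN.
  have h2 : F (f N) * E K <= r * E K * E K by rewrite ler_wpM2r.
  have h3 : 0 <= E 1 * r by rewrite mulr_ge0 // ltW.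
  have h4 : 0 <= E K * E K * \sum_(i <= i0 < N) F (f i0).
    by rewrite !mulr_ge0.
  by rewrite /A /G; lra.
have key i j : (n0 <= i < N1)%N -> (n0 <= j < N2)%N ->
    Num.min (F (g i)) (F (h j)) <=
    C1 * (A g N1 i + A h N2 j) * (psi (i + j - C)%N%:R)^-1.
  move=> hi hj; have hk := sep i j _ _.
  have {}hk : (i + j - C)%N%:R <= k (g i) (h j) by apply: hk; clear -hi hj; lia.
  have u1 : (1 : R) <= (i + j - C)%N%:R by rewrite ler1n; clear -hi hj hn3; lia.
  have ut : t0 <= k (g i) (h j).
    apply: le_trans hk; apply: le_trans (_ : n0%:R - C%:R <= _); first lra.
    by rewrite -natrB ?ler_nat; clear -hi hj hn3; lia.
  have m0 : 0 <= Num.min (F (g i)) (F (h j)) by rewrite le_min !ltW.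
  rewrite ler_pdivlMr ?psi_gt0 // mulrC.
  apply: le_trans (ler_wpM2r m0 (psi_homo u1 hk)) _.
  apply: le_trans (q_uniform ut) _.
  rewrite /C1 -!mulrA ler_pM2l //.
  have qx : q (g i) x <= L * (G * A g N1 i) by apply: leg => //; clear -hi hj; lia.
  have qy : q (h j) y <= L * (G * A h N2 j) by apply: leg => //; clear -hi hj; lia.
  apply: le_trans (q4 (g i) x y (h j)) _; rewrite ler_pM2l // (q_sym y).
  have a1 := A_ge g N1 i; have a2 := le_trans (ltW r0) (A_ge h N2 j).
  move: qx qy qr a1 a2; set a := A g N1 i; set b := A h N2 j; lra.
have rp : r <= l / (2 * lam) ^+ p by rewrite ge_min lexx.
have : p%:R <= 4 * lam * C1 * S.
  apply: (@two_tails R (F \o g) (F \o h) (fun j => (psi (j - C)%N%:R)^-1)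
    N1 N2 n0 r l lam C1 S) => //.
  - by move=> i; exact: ltW (F_gt0 _).
  - by move=> i; exact: ltW (F_gt0 _).
  - by move=> i; rewrite invr_ge0 psi_ge0.
  - by move=> n; exact: A_step Fx gr xN.
  - by move=> n; exact: A_step Fy hr yN.
  - move=> u v hu; have Cu : (C < u)%N by clear -hu hn3; lia.
    rewrite -(subnK (ltnW Cu)) big_addn.
    under eq_bigr do rewrite addnK.
    by apply: psi_tail_le; rewrite subn_gt0.
  - exact: ltnW.
  - exact: ltnW.
  - exact: A_start Fx gr n0N1.
  - exact: A_start Fy hr n0N2.
by move: hp; lra.
Qed.

End uniform_weight.

(** * The Gromov boundary *)

Lemma limn_einf_geP {R : realType} (u : nat -> R) (M : R) :
  (M%:E <= limn_einf (fun i => (u i)%:E))%E <->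
  forall e, 0 < e -> exists N, forall i, (N <= i)%N -> M - e <= u i.
Proof.
rewrite limn_einf_lim (cvg_lim _ (@cvg_einfs_sup _ _)) //.
split=> [h e e0|h].
  have : ((M - e)%:E < ereal_sup (range (einfs (fun i => (u i)%:E))))%E.
    by apply: lt_le_trans h; rewrite lte_fin gtrBl.
  move=> /ereal_sup_gt[_ [N _ <-] hN]; exists N => i Ni.
  rewrite -lee_fin; apply/ltW/(lt_le_trans hN)/ereal_inf_lbound.
  by exists i.
apply/lee_addgt0Pr => e e0; have [N hN] := h e e0.
rewrite -leeBlDr // -EFinB.
apply: le_trans (_ : einfs (fun i => (u i)%:E) N <= _)%E; last first.
  by apply: ereal_sup_ubound; exists N.
by apply: le_ereal_inf_tmp => _ [i /= Ni <-]; rewrite lee_fin hN.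
Qed.

(** * Chains for a quasimetric *)

Section chain_lemma.
Context {R : realType} {X : Type} (rho : X -> X -> R) (C : R).
Hypothesis rho_ge0 : forall x y, 0 <= rho x y.
Hypothesis rho_max : forall x y z, rho x z <= C * Num.max (rho x y) (rho y z).
Hypothesis C2 : C * C <= 2.
Hypothesis C1 : 1 <= C.
Let C0 : 0 <= C. Proof. exact: le_trans C1. Qed.
Hypothesis rhoxx : forall x, rho x x = 0.

(* Frink's chain lemma: split the chain where half of its length is reached. *)
Lemma quasimetric_chain (c : nat -> X) n :
  rho (c 0) (c n) <= C * C * \sum_(0 <= i < n) rho (c i) (c i.+1).
Proof.
elim/ltn_ind: n c => n ih c.
have [->|n0] := posnP n; first by rewrite rhoxx big_geq // mulr0.
set s := \sum_(0 <= i < n) _.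
have s0 : 0 <= s by apply: sumr_ge0.
have part m m' : (m <= m' <= n)%N -> \sum_(m <= i < m') rho (c i) (c i.+1) <= s.
  move=> /andP[mm mn]; rewrite /s (big_cat_nat (leq0n m) (leq_trans mm mn)) /=.
  by rewrite (big_cat_nat mm mn) /= ler_wpDl ?ler_wpDr ?sumr_ge0.
(* For the last such [m], the parts before [m] and after [m.+1] each carry at most [s / 2], so
   induction and [C * C <= 2] bound their end distances by [s]; the single link between them is a
   summand of [s]. Joining the three costs [C] twice. *)
pose P m := (m <= n.-1)%N && (\sum_(0 <= i < m) rho (c i) (c i.+1) <= s / 2).
have exP : exists m, P m by exists 0%N; rewrite /P big_geq // divr_ge0.
have [m /andP[mn hm] mmax] := ex_maxnP exP (fun m (h : P m) => (andP h).1).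
have mn' : (m < n)%N by clear -mn n0; lia.
have left_ : rho (c 0) (c m) <= s.
  apply: le_trans (ih m mn' c) _; move: hm C2.
  have : 0 <= \sum_(0 <= i < m) rho (c i) (c i.+1) by apply: sumr_ge0.
  set t := \sum_(0 <= i < m) _ => t0 ht C2'.
  apply: le_trans (ler_wpM2r t0 C2') _; lra.
have mid : rho (c m) (c m.+1) <= s.
  by have := part m m.+1; rewrite big_nat1; apply; rewrite leqnSn.
have right_ : rho (c m.+1) (c n) <= s.
  have [nm|nm] := leqP n m.+1.
    have -> : m.+1 = n by clear -nm mn'; lia.
    by rewrite rhoxx.
  have h2 : \sum_(m.+1 <= i < n) rho (c i) (c i.+1) <= s / 2.
    have hP : ~~ P m.+1 by apply/negP => /mmax; rewrite ltnn.
    move: hP; rewrite /P negb_and -ltnNge -ltNge.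
    move=> /orP[h|h]; first by clear -h nm; lia.
    have : s = \sum_(0 <= i < m.+1) rho (c i) (c i.+1) +
               \sum_(m.+1 <= i < n) rho (c i) (c i.+1).
      by rewrite /s (big_cat_nat (leq0n m.+1) (ltnW nm)).
    by move: h; lra.
  have nm1 : (n - m.+1 < n)%N by clear -n0; lia.
  have := ih _ nm1 (fun i => c (i + m.+1)%N).
  rewrite add0n subnK; last by apply: ltnW.
  rewrite (_ : \sum_(0 <= i < n - m.+1) _ = \sum_(m.+1 <= i < n) rho (c i) (c i.+1)).
    move=> /le_trans; apply; move: h2 C2.
    have : 0 <= \sum_(m.+1 <= i < n) rho (c i) (c i.+1) by apply: sumr_ge0.
    set t := \sum_(m.+1 <= i < n) _ => t0 ht C2'.
    apply: le_trans (ler_wpM2r t0 C2') _; lra.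
  have := @big_addn _ 0 +%R 0 n m.+1 xpredT (fun i => rho (c i) (c i.+1)).
  by rewrite add0n => ->.
apply: le_trans (rho_max _ (c m) _) _; rewrite -mulrA ler_wpM2l //.
have Cs : s <= C * s by rewrite ler_peMl.
rewrite ge_max (le_trans left_ Cs) /=.
apply: le_trans (rho_max _ (c m.+1) _) _; rewrite ler_wpM2l //.
by rewrite ge_max mid right_.
Qed.

End chain_lemma.

(** * Bourdon metrics and their gauges *)

Section bourdon.
Context {R : realType} {T : Type} (k : T -> T -> R) (delta eps : R) (w : T).
Hypothesis kxx : forall x, k x x = 0.
Hypothesis k_sym : forall x y, k x y = k y x.
Hypothesis k_delta : gromov_delta k delta.
Hypothesis delta0 : 0 <= delta.
Hypothesis eps0 : 0 < eps.
Hypothesis eps_delta : eps * (5 * delta) < 1.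
Local Notation gp := (gromov_product k w).
Local Notation bd := (gromov_classes k w).
Implicit Types (a b : nat -> T) (xi eta zeta : bd).

Lemma gromov_sequenceP a : gromov_sequence k w a <->
  forall M : R, exists N, forall i j, (N <= i)%N -> (N <= j)%N -> M <= gp (a i) (a j).
Proof.
split=> [h M|h].
  have /cvgryPge/(_ M)[[A B] /= [[N1 _ hA] [N2 _ hB]] AB] := h.
  exists (maxn N1 N2) => i j; rewrite !geq_max => /andP[i1 _] /andP[_ j2].
  by apply: (AB (i, j)); split; [exact: hA|exact: hB].
apply/cvgryPge => M; have [N hN] := h M.
exists ([set i | (N <= i)%N], [set i | (N <= i)%N]) => /=.
  by split; exists N.
by move=> [i j] /= [Ni Nj]; exact: hN.
Qed.

Lemma gromov_equivP a b : gromov_equiv k w a b <->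
  forall M : R, exists N, forall i, (N <= i)%N -> M <= gp (a i) (b i).
Proof.
split=> [h M|h].
  by have /cvgryPge/(_ M)[N _ hN] := h; exists N.
by apply/cvgryPge => M; have [N hN] := h M; exists N.
Qed.

Lemma gromov_sequence_equiv a : gromov_sequence k w a -> gromov_equiv k w a a.
Proof.
move=> /gromov_sequenceP h; apply/gromov_equivP => M.
by have [N hN] := h M; exists N => i Ni; exact: hN.
Qed.

Lemma gromov_class_seq xi a : set_val xi a -> gromov_sequence k w a.
Proof. by rewrite set_valE; have [b _ <-] := set_valP xi; case. Qed.

Lemma gromov_equiv_trans a b c : gromov_equiv k w a b -> gromov_equiv k w b c ->
  gromov_equiv k w a c.
Proof.
move=> /gromov_equivP ab /gromov_equivP bc; apply/gromov_equivP => M.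
have [N1 h1] := ab (M + delta); have [N2 h2] := bc (M + delta).
exists (maxn N1 N2) => i; rewrite geq_max => /andP[/h1 i1 /h2 i2].
have := k_delta (a i) (c i) (b i) w; apply: le_trans.
by rewrite lerBrDr le_min i1 i2.
Qed.

Lemma gromov_equiv_sym a b : gromov_equiv k w a b -> gromov_equiv k w b a.
Proof.
move=> /gromov_equivP h; apply/gromov_equivP => M; have [N hN] := h M.
by exists N => i /hN; rewrite (gromov_productC k_sym).
Qed.

Lemma gromov_class_equiv xi a b : set_val xi a -> set_val xi b ->
  gromov_equiv k w a b.
Proof.
rewrite set_valE; have [c _ <-] := set_valP xi; move=> [_ ca] [_ cb].
exact: gromov_equiv_trans (gromov_equiv_sym ca) cb.
Qed.

Lemma gromov_class_neq0 xi : exists a, set_val xi a.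
Proof.
have [a sa e] := set_valP xi; exists a; rewrite set_valE -e; split => //.
exact: gromov_sequence_equiv.
Qed.

Lemma boundary_product_geP xi eta (M : R) :
  (M%:E <= boundary_product xi eta)%E <->
  forall a b, set_val xi a -> set_val eta b -> forall e, 0 < e ->
    exists N, forall i, (N <= i)%N -> M - e <= gp (a i) (b i).
Proof.
split=> [h a b xa eb|h].
  apply/limn_einf_geP; apply: le_trans h _; apply: ereal_inf_lbound.
  by exists a => //; exists b.
apply: le_ereal_inf_tmp => _ [a xa [b eb <-]].
by apply/limn_einf_geP; exact: h.
Qed.

(** The product is an infimum over all representatives, so one arbitrary sequence of the middle
    class serves both sides and the constant [delta] of the space is kept. *)
Lemma boundary_product_delta xi eta zeta (M : R) :
  (M%:E <= boundary_product xi eta)%E -> (M%:E <= boundary_product eta zeta)%E ->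
  ((M - delta)%:E <= boundary_product xi zeta)%E.
Proof.
move=> /boundary_product_geP h1 /boundary_product_geP h2.
apply/boundary_product_geP => a c xa zc e e0.
have [b eb] := gromov_class_neq0 eta.
have [N1 k1] := h1 a b xa eb e e0; have [N2 k2] := h2 b c eb zc e e0.
exists (maxn N1 N2) => i; rewrite geq_max => /andP[/k1 i1 /k2 i2].
have := k_delta (a i) (c i) (b i) w; apply: le_trans.
by rewrite lerBrDr le_min; apply/andP; split; lra.
Qed.

(** The cost of one link in the chains of [bourdon_dist], to which it is comparable within a factor
    2. *)
Definition visual_gauge xi eta : R :=
  fine (expeR (- (eps%:E * boundary_product xi eta)))%E.

Lemma visual_gauge_ge0 xi eta : 0 <= visual_gauge xi eta.
Proof. by rewrite fine_ge0 // expeR_ge0. Qed.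

(** Excludes the value [-oo], where [fine] of an infinite exponential would be 0 and distant classes
    would seem close. *)
Lemma boundary_product_ge xi eta : ((- delta)%:E <= boundary_product xi eta)%E.
Proof.
apply/boundary_product_geP => a b _ _ e e0; exists 0%N => i _.
rewrite /gromov_product; have := rough_triangle kxx k_sym k_delta (a i) (b i) w.
by rewrite (k_sym w); lra.
Qed.

Lemma visual_gauge_leP xi eta (M : R) :
  visual_gauge xi eta <= expR (- (eps * M)) <->
  (M%:E <= boundary_product xi eta)%E.
Proof.
have := boundary_product_ge xi eta; rewrite /visual_gauge.
case: (boundary_product xi eta) => [p _|_|//].
  rewrite -EFinM -EFinN /= ler_expR lerN2 ler_pM2l // lee_fin //.
by rewrite mulry gtr0_sg // mul1e /= leey; split => // _; exact: expR_ge0.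
Qed.

Lemma visual_gauge_le_prod xi eta (t : R) : 0 < t ->
  visual_gauge xi eta <= t <-> ((- (ln t / eps))%:E <= boundary_product xi eta)%E.
Proof.
move=> t0; rewrite -visual_gauge_leP mulrN opprK mulrC divfK ?gt_eqF //.
by rewrite lnK.
Qed.

Lemma visual_gauge_max xi eta zeta : visual_gauge xi zeta <=
  expR (eps * delta) * Num.max (visual_gauge xi eta) (visual_gauge eta zeta).
Proof.
set m := Num.max _ _.
have m0 : 0 <= m by rewrite le_max visual_gauge_ge0.
have E0 : 0 < expR (eps * delta) by exact: expR_gt0.
(* The maximum may be 0, where the logarithm is meaningless; hence the estimate at every level
   [m + t]. *)
rewrite mulrC -ler_pdivrMr //; apply/ler_addgt0Pr => t t0.
rewrite ler_pdivrMr //.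
have mt : 0 < m + t by rewrite ltr_wpDl.
have [h1 h2] : visual_gauge xi eta <= m + t /\ visual_gauge eta zeta <= m + t.
  have : m <= m by []; rewrite {1}/m ge_max => /andP[h1 h2]; split; lra.
have := boundary_product_delta ((visual_gauge_le_prod _ _ mt).1 h1)
  ((visual_gauge_le_prod _ _ mt).1 h2).
move=> /visual_gauge_leP; congr (_ <= _).
rewrite (_ : - (eps * _) = ln (m + t) + eps * delta); last first.
  by field; rewrite gt_eqF.
by rewrite expRD lnK.
Qed.

(** The condition [eps * (5 * delta) < 1] enters here: it gives [2 * eps * delta < 2 / 5], and
    [expR (1 / 2) <= 2] because [expR (- (1 / 2)) >= 1 / 2]. Frink's lemma asks for exactly this
    constant. *)
Lemma expR_delta2 : expR (eps * delta) * expR (eps * delta) <= 2.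
Proof.
rewrite -expRD.
have h : eps * delta + eps * delta <= 1 / 2.
  have : 0 <= eps * delta by rewrite mulr_ge0 // ltW.
  by move: eps_delta; lra.
apply: le_trans (_ : expR (1 / 2) <= _); first by rewrite ler_expR.
have h1 := expR_ge1Dx (- (1 / 2) : R).
rewrite -[1/2]opprK expRN -[leRHS]invrK lef_pV2 ?posrE ?invr_gt0 ?expR_gt0 //.
by apply: le_trans h1; lra.
Qed.

Lemma visual_gaugexx xi : visual_gauge xi xi = 0.
Proof.
rewrite /visual_gauge (_ : boundary_product xi xi = +oo%E).
  by rewrite mulry gtr0_sg // mul1e.
apply/eqyP => M M0; apply/boundary_product_geP => a b xa xb e e0.
have /gromov_equivP/(_ (M - e)) := gromov_class_equiv xa xb.
exact.
Qed.

Lemma bourdon_dist_le xi eta : bourdon_dist eps xi eta <= visual_gauge xi eta.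
Proof.
apply: ge_inf.
  exists 0 => _ [n [c [_ _ _ ->]]]; apply: sumr_ge0 => i _.
  exact: visual_gauge_ge0.
exists 1%N, (fun i => if i is 0 then xi else eta); split => //.
by rewrite big_nat1.
Qed.

Lemma bourdon_dist_ge xi eta : visual_gauge xi eta <= 2 * bourdon_dist eps xi eta.
Proof.
rewrite mulrC -ler_pdivrMr //; apply: lb_le_inf.
  exists (visual_gauge xi eta), 1%N, (fun i => if i is 0 then xi else eta).
  by split => //; rewrite big_nat1.
move=> _ [n [c [n0 c0 cn ->]]]; rewrite ler_pdivrMr // mulrC.
rewrite -c0 -cn; apply: le_trans (@quasimetric_chain _ _ visual_gauge
  (expR (eps * delta)) visual_gauge_ge0 visual_gauge_max expR_delta2 _
  visual_gaugexx c n) _.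
  by rewrite -expR0 ler_expR mulr_ge0 // ltW.
by rewrite ler_wpM2r ?expR_delta2 // sumr_ge0 // => i _; exact: visual_gauge_ge0.
Qed.

End bourdon.

Lemma dist_space_open {R : realType} {T : choiceType} (d : T -> T -> R)
  (U : set (dist_space d)) : open U = dist_open d U.
Proof. by []. Qed.

(* [X] is the completion or its one-point compactification, [j] the embedding
   of the space and [q] a quasimetric on X inducing its topology at the points
   outside the image of [j]. *)
Section boundary_homeomorphism.
Context {R : realType} {T : Type} (k : T -> T -> R) (delta eps : R) (w : T).
Hypothesis kxx : forall x, k x x = 0.
Hypothesis k_sym : forall x y, k x y = k y x.
Hypothesis k_delta : gromov_delta k delta.
Hypothesis delta0 : 0 <= delta.
Hypothesis eps0 : 0 < eps.
Hypothesis eps_delta : eps * (5 * delta) < 1.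
Context {X : topologicalType} (j : T -> X) (q : X -> X -> R) (F : T -> R).
Variables (L C : R).
Local Notation gp := (gromov_product k w).
Local Notation bd := (gromov_classes k w).
Local Notation B := (~` range j).
Hypothesis L1 : 1 <= L.
Hypothesis C1 : 1 <= C.
Hypothesis q_sym : forall x y, q x y = q y x.
Hypothesis q_ge0 : forall x y, 0 <= q x y.
Hypothesis q_eq0 : forall x y, q x y = 0 -> x = y.
Hypothesis q_triangle : forall x y z, q x z <= L * (q x y + q y z).
Hypothesis F_small : forall e, 0 < e -> exists M, forall x, M <= gp x x -> F x <= e.
Hypothesis q_small : forall e, 0 < e ->
  exists M, forall x y, M <= gp x y -> q (j x) (j y) <= e.
Hypothesis gp_large : forall M, exists2 r, 0 < r & forall x y,
  F x <= r -> F y <= r -> q (j x) (j y) <= r -> M <= gp x y.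
Hypothesis q_complete : forall a : nat -> T,
  (forall e, 0 < e -> exists N, forall m n, (N <= m)%N -> (N <= n)%N ->
    q (j (a m)) (j (a n)) <= e) ->
  (forall e, 0 < e -> exists N, forall n, (N <= n)%N -> F (a n) <= e) ->
  exists2 y, B y & forall e, 0 < e ->
    exists N, forall n, (N <= n)%N -> q (j (a n)) y <= e.
Hypothesis q_dense : forall y, B y -> forall e, 0 < e -> exists x, q (j x) y <= e.
Hypothesis F_le : forall x y, B y -> F x <= C * q (j x) y.
Hypothesis nbhs_q : forall y U, B y -> nbhs y U ->
  exists2 r, 0 < r & forall z, B z -> q y z <= r -> U z.
Hypothesis q_nbhs : forall y r, B y -> 0 < r ->
  exists2 U, nbhs y U & forall z, B z -> U z -> q y z <= r.

(** Convergence is measured by [q], since the assumptions compare [q] with the topology of [X] among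
    boundary points and not along [j \o a]. *)
Definition tends (a : nat -> T) (y : X) : Prop := forall e : R, 0 < e ->
  exists N, forall n, (N <= n)%N -> q (j (a n)) y <= e.

Let L0 : 0 < L. Proof. exact: lt_le_trans L1. Qed.
Let C0 : 0 < C. Proof. exact: lt_le_trans C1. Qed.

Let q_tri_le x y z e : q x y <= e / (2 * L) -> q y z <= e / (2 * L) -> q x z <= e.
Proof.
move=> h1 h2; apply: le_trans (q_triangle x y z) _.
rewrite mulrC -ler_pdivlMr //; apply: le_trans (lerD h1 h2) _.
by rewrite le_eqVlt; apply/orP; left; apply/eqP; field; rewrite gt_eqF.
Qed.

Let half_gt0 e : 0 < e -> 0 < e / (2 * L).
Proof. by move=> e0; rewrite divr_gt0 // mulr_gt0. Qed.

Let q_eq x y : (forall e, 0 < e -> q x y <= e) -> x = y.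
Proof.
move=> h; apply: q_eq0; apply/le_anti; rewrite q_ge0 andbT.
by apply/ler_addgt0Pr => e /h; rewrite add0r.
Qed.

Lemma tends_unique a y z : tends a y -> tends a z -> y = z.
Proof.
move=> ay az; apply: q_eq => e e0.
have [N1 h1] := ay _ (half_gt0 e0); have [N2 h2] := az _ (half_gt0 e0).
by apply: (@q_tri_le _ (j (a (maxn N1 N2)))); rewrite ?(q_sym y);
  [apply: h1; exact: leq_maxl|apply: h2; exact: leq_maxr].
Qed.

Lemma tends_equiv a b y : gromov_equiv k w a b -> tends a y -> tends b y.
Proof.
move=> /gromov_equivP ab ay e e0.
have [M hM] := q_small (half_gt0 e0).
have [N1 h1] := ab M; have [N2 h2] := ay _ (half_gt0 e0).
exists (maxn N1 N2) => n; rewrite geq_max => /andP[/h1 n1 /h2 n2].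
by apply: (@q_tri_le _ (j (a n))); rewrite // q_sym; exact: hM.
Qed.

Lemma tends_weight a y : B y -> tends a y -> forall e, 0 < e ->
  exists N, forall n, (N <= n)%N -> F (a n) <= e.
Proof.
move=> By ay e e0; have [N hN] := ay _ (divr_gt0 e0 C0).
exists N => n /hN h; apply: le_trans (F_le _ By) _.
by rewrite mulrC -ler_pdivlMr.
Qed.

Lemma tends_gp a b y z M : B y -> B z -> tends a y -> tends b z ->
  exists2 r, 0 < r & (q y z <= r -> exists N, forall m n, (N <= m)%N -> (N <= n)%N ->
    M <= gp (a m) (b n)).
Proof.
move=> By Bz ay bz; have [r r0 hr] := gp_large M.
have r2 := half_gt0 r0; have r4 := half_gt0 r2.
exists (r / (2 * L) / (2 * L)) => // yz.
have [N1 h1] := tends_weight By ay r0; have [N2 h2] := tends_weight Bz bz r0.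
have [N3 h3] := ay _ r2; have [N4 h4] := bz _ r4.
exists (maxn (maxn N1 N2) (maxn N3 N4)) => m n.
rewrite !geq_max => /andP[/andP[m1 _] /andP[m3 _]] /andP[/andP[_ n2] /andP[_ n4]].
apply: hr; [exact: h1|exact: h2|].
apply: (@q_tri_le _ y); first exact: h3.
by apply: (@q_tri_le _ z) => //; rewrite q_sym; exact: h4.
Qed.

(** Go from [x] to a nearby point of the space and back. *)
Let qxx x : B x -> q x x <= 0.
Proof.
move=> Bx; apply/ler_addgt0Pr => e e0; rewrite add0r.
have [z hz] := q_dense Bx (half_gt0 e0).
by apply: (@q_tri_le _ (j z)); rewrite // q_sym.
Qed.

Lemma tends_gromov a b y : B y -> tends a y -> tends b y ->
  forall M, exists N, forall m n, (N <= m)%N -> (N <= n)%N -> M <= gp (a m) (b n).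
Proof.
move=> By ay by_ M; have [r r0 h] := tends_gp M By By ay by_.
by apply: h; apply: le_trans (qxx By) (ltW r0).
Qed.

Lemma tends_sequence a y : B y -> tends a y -> gromov_sequence k w a.
Proof. by move=> By ay; apply/gromov_sequenceP; exact: (tends_gromov By ay ay). Qed.

Lemma tends_equivalent a b y : B y -> tends a y -> tends b y ->
  gromov_equiv k w a b.
Proof.
move=> By ay by_; apply/gromov_equivP => M.
by have [N h] := tends_gromov By ay by_ M; exists N => i Ni; exact: h.
Qed.

Lemma gromov_sequence_tends a : gromov_sequence k w a ->
  exists2 y, B y & tends a y.
Proof.
move=> /gromov_sequenceP sa; apply: q_complete => e e0.
  have [M hM] := q_small e0; have [N hN] := sa M.
  by exists N => m n Nm Nn; apply: hM; exact: hN.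
have [M hM] := F_small e0; have [N hN] := sa M.
by exists N => n Nn; apply: hM; exact: hN.
Qed.

Lemma boundary_point_tends y : B y -> exists a, tends a y.
Proof.
move=> By; have h n : exists x, q (j x) y <= n.+1%:R^-1 by apply: q_dense.
have [a ha] := choice h; exists a => e e0.
have [N hN] := nat_ge e^-1; exists N => n Nn; apply: le_trans (ha n) _.
rewrite -[leRHS]invrK lef_pV2 ?posrE ?invr_gt0 //.
by apply: le_trans hN _; rewrite ler_nat ltnW.
Qed.

(** A large product makes [q] small, so equivalent sequences share their limit and it depends on the
    class alone. *)
Lemma class_endpoint (xi : bd) :
  {y : set_type B | forall a, set_val xi a -> tends a (set_val y)}.
Proof.
apply: cid; have [a xa] := gromov_class_neq0 xi.
have [y By ay] := gromov_sequence_tends (gromov_class_seq xa).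
exists (SigSub (mem_set By)) => b xb.
exact: tends_equiv (gromov_class_equiv k_sym k_delta xa xb) ay.
Qed.

(** All sequences tending to [y] form exactly one class: [gp_large] makes the products of two of
    them tend to infinity. *)
Lemma endpoint_class_subproof (y : set_type B) :
  gromov_classes k w [set b | tends b (set_val y)].
Proof.
have By : B (set_val y) by rewrite set_valE; exact: set_valP.
have [a ay] := boundary_point_tends By.
exists a; first exact: tends_sequence ay.
apply/seteqP; split => b /=; first by case=> _ /tends_equiv; apply.
by move=> bY; split; [exact: tends_sequence bY|exact: tends_equivalent ay bY].
Qed.

Definition endpoint_class (y : set_type B) : bd :=
  SigSub (mem_set (endpoint_class_subproof y)).

Definition endpoint (xi : bd) : set_type B := sval (class_endpoint xi).

Lemma endpointP (xi : bd) a : set_val xi a -> tends a (set_val (endpoint xi)).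
Proof. exact: (svalP (class_endpoint xi)). Qed.

Let BV (y : set_type B) : B (set_val y).
Proof. by rewrite set_valE; exact: set_valP. Qed.

Lemma endpointK : cancel endpoint endpoint_class.
Proof.
move=> xi; apply: val_inj => /=; apply/seteqP; split => [b /= bx|b xb].
  have [a xa] := gromov_class_neq0 xi; have ax := endpointP xa.
  have ab := tends_equivalent (@BV _) ax bx.
  have sb := tends_sequence (@BV _) bx.
  have [c _ e] := set_valP xi; move: xa; rewrite set_valE -e => -[_ ca].
  suff : \val xi b by []; rewrite -e.
  by split => //; exact: gromov_equiv_trans ca ab.
exact: endpointP.
Qed.

Lemma endpoint_classK : cancel endpoint_class endpoint.
Proof.
move=> y; have [a ay] := boundary_point_tends (@BV y).
have /endpointP h : set_val (endpoint_class y) a by [].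
apply: val_inj; exact: (tends_unique h ay).
Qed.

Lemma endpoint_continuous :
  continuous (endpoint : gromov_boundary k w eps -> set_type B).
Proof.
apply/continuousP => _ [V oV <-]; rewrite dist_space_open => xi /= Vxi.
have /(nbhs_q (@BV _))[r r0 hr] : nbhs (set_val (endpoint xi)) V.
  by apply: open_nbhs_nbhs.
have r2 := half_gt0 r0; have r4 := half_gt0 r2.
have [M hM] := q_small r4.
(* The summand 1 pays for the loss in passing from a boundary product to the products of
   representatives. *)
have E0 : 0 < expR (- (eps * (M + 1))) :> R by exact: expR_gt0.
exists (expR (- (eps * (M + 1))) / 2); first by rewrite divr_gt0.
move=> eta xe; apply: hr; first exact: BV.
have : visual_gauge eps xi eta <= expR (- (eps * (M + 1))).
  apply: le_trans (bourdon_dist_ge kxx k_sym k_delta delta0 eps0 eps_delta _ _) _.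
  by move: xe; lra.
move/(visual_gauge_leP kxx k_sym k_delta eps0) => /boundary_product_geP h.
have [a xa] := gromov_class_neq0 xi; have [b eb] := gromov_class_neq0 eta.
have [N1 h1] := h a b xa eb 1 ltr01; rewrite addrK in h1.
have [N2 h2] := endpointP xa r2; have [N3 h3] := endpointP eb r4.
pose n := maxn N1 (maxn N2 N3).
have [n1 n2 n3] : [/\ (N1 <= n)%N, (N2 <= n)%N & (N3 <= n)%N].
  by rewrite /n; split; rewrite !leq_max leqnn ?orbT.
apply: (@q_tri_le _ (j (a n))); first by rewrite q_sym; exact: h2.
apply: (@q_tri_le _ (j (b n))); last exact: h3.
by apply: hM; exact: h1.
Qed.

Lemma endpoint_class_continuous :
  continuous (endpoint_class : set_type B -> gromov_boundary k w eps).
Proof.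
apply/continuousP => U; rewrite dist_space_open => oU; rewrite openE => y Uy.
have [r r0 hr] := oU (endpoint_class y) Uy.
(* The gauge is at most [r / 2] exactly when the boundary product is at least this [M]. *)
pose M := - (ln (r / 2) / eps).
have r2 : 0 < r / 2 by rewrite divr_gt0.
have [s s0 hs] := gp_large M.
have s2 := half_gt0 s0; have s4 := half_gt0 s2.
have [V nV hV] := q_nbhs (@BV y) s4.
have nV' : nbhs y (set_val @^-1` V) by apply: initial_continuous.
apply: filterS nV' => z /= Vz; apply: hr.
apply: le_lt_trans (bourdon_dist_le _ _ _) _.
apply: le_lt_trans (_ : r / 2 < r); last by move: r0; lra.
apply/(visual_gauge_le_prod kxx k_sym k_delta eps0) => //.
apply/boundary_product_geP => a b /= ay bz e e0.
have {}ay : tends a (set_val y) by [].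
have {}bz : tends b (set_val z) by [].
have [N1 h1] := tends_weight (@BV y) ay s0; have [N2 h2] := tends_weight (@BV z) bz s0.
have [N3 h3] := ay _ s2; have [N4 h4] := bz _ s4.
exists (maxn (maxn N1 N2) (maxn N3 N4)) => n.
rewrite !geq_max => /andP[/andP[n1 n2] /andP[n3 n4]].
apply: le_trans (_ : M <= _); first by rewrite gerBl ltW.
apply: hs; [exact: h1|exact: h2|].
apply: (@q_tri_le _ (set_val y)); first exact: h3.
apply: (@q_tri_le _ (set_val z)); last by rewrite q_sym; exact: h4.
by apply: hV => //; exact: BV.
Qed.

Theorem gromov_boundary_homeomorphic :
  homeomorphic (gromov_boundary k w eps) (set_type B).
Proof.
exists endpoint, endpoint_class; split; [exact: endpointK|exact: endpoint_classK|
  exact: endpoint_continuous|exact: endpoint_class_continuous].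
Qed.

End boundary_homeomorphism.

(** * Uniform spaces *)

(** A continuous injection of an interval is strictly monotone. A decreasing [psi] would never
    exceed [psi 0], yet [psi] attains [psi 0 + 1]. *)
Lemma nneg_homeo_homo {R : realType} (phi psi : R -> R) : nneg_homeo phi psi ->
  forall s t, 0 <= s -> s < t -> psi s < psi t.
Proof.
move=> [phiK psiK _ cpsi] s t s0 st.
have inj : {in `[0, +oo[ &, injective psi}.
  move=> x y; rewrite !in_itv /= !andbT => x0 y0 e.
  by rewrite -(psiK x x0).2 -(psiK y y0).2 e.
have t0 : 0 <= t by exact: le_trans s0 (ltW st).
have in0 x : 0 <= x -> x \in `[0, +oo[ by move=> x0; rewrite in_itv /= andbT.
have [h|h] := itv_continuous_inj_mono cpsi inj; first by rewrite h ?in0.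
have y0 : 0 <= psi 0 + 1 by rewrite addr_ge0 // (psiK 0 (lexx 0)).1.
have [p0 pK] := phiK _ y0.
have : psi (phi (psi 0 + 1)) <= psi 0.
  move: p0; rewrite le_eqVlt => /predU1P[<-//|p0].
  by apply: ltW; rewrite h ?in0 // ltW.
by rewrite pK; lra.
Qed.

Lemma nneg_homeo_gt0 {R : realType} (phi psi : R -> R) : nneg_homeo phi psi ->
  forall t, 0 < t -> 0 < psi t.
Proof.
move=> h t t0; apply: le_lt_trans (nneg_homeo_homo h (lexx 0) t0).
by case: h => _ /(_ 0 (lexx 0))[].
Qed.

Lemma nneg_homeo_homo_le {R : realType} (phi psi : R -> R) : nneg_homeo phi psi ->
  forall s t, 0 <= s -> s <= t -> psi s <= psi t.
Proof.
move=> h s t s0; rewrite le_eqVlt => /predU1P[->//|st].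
exact/ltW/(nneg_homeo_homo h).
Qed.

(** Integral test: by monotonicity the term of index [i.+1] is at most the integral over [[i,
    i.+1[]; the term of index 1 is added separately. *)
Lemma sum_le_integral {R : realType} (Psi : R -> R) :
  (forall s t, 1 <= s -> s <= t -> Psi s <= Psi t) ->
  (forall s, 1 <= s -> 0 < Psi s) ->
  {within `[1, +oo[, continuous Psi} ->
  (\int[lebesgue_measure]_(t in `[1%R, +oo[) ((Psi t)^-1)%:E < +oo)%E ->
  exists S : R, forall n, \sum_(1 <= i < n) (Psi i%:R)^-1 <= S.
Proof.
move=> homo pos cPsi fin.
pose g (t : R) := ((Psi t)^-1)%:E : \bar R.
have g0 (t : R) : 1 <= t -> (0 <= g t)%E.
  by move=> t1; rewrite lee_fin invr_ge0 ltW // pos.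
have mg : measurable_fun (`[1%R, +oo[ : set R) g.
  apply/measurable_EFinP; apply: subspace_continuous_measurable_fun => //.
  apply/subspace_continuousP => t t1.
  apply: cvgV; first by rewrite gt_eqF // pos //; move: t1; rewrite /= in_itv /= andbT.
  by move/subspace_continuousP: cPsi; apply.
have sub (a b : R) : 1 <= a -> `[a, b[ `<=` `[1%R, +oo[.
  by move=> a1 t /=; rewrite !in_itv /= andbT => /andP[+ _]; apply: le_trans.
have step n : (0 < n)%N ->
    ((\sum_(1 <= i < n) (Psi i.+1%:R)^-1)%:E <=
     \int[lebesgue_measure]_(t in `[1%R, n%:R[) g t)%E.
  elim: n => // n ih _.
  have [->|n0] := posnP n.
    rewrite big_geq //; apply: integral_ge0 => t /=; rewrite in_itv /= => /andP[t1 _].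
    exact: g0.
  have n1 : (1:R) <= n%:R by rewrite ler1n.
  have nn : (n%:R : R) <= n.+1%:R by rewrite ler_nat.
  rewrite big_nat_recr //= EFinD.
  have -> : `[1, n.+1%:R[%classic =
      `[1, n%:R[%classic `|` `[n%:R, n.+1%:R[%classic :> set R.
    by rewrite -itv_bndbnd_setU // bnd_simp.
  rewrite ge0_integral_setU //.
  - apply: leeD; first exact: ih.
    apply: le_trans (_ : \int[lebesgue_measure]_(t in `[n%:R, n.+1%:R[)
        (cst ((Psi n.+1%:R)^-1)%:E t) <= _)%E.
      rewrite integral_cst //= lebesgue_measure_itv /= lte_fin ltr_nat ltnSn.
      by rewrite -EFinD -natr1 addrAC subrr add0r mule1.
    apply: ge0_le_integral => //.
    + move=> t _ /=; apply: g0; by rewrite ler1n.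
    + by apply: measurable_funS mg => //; exact: sub.
    + move=> t /=; rewrite in_itv /= => /andP[nt tn]; rewrite lee_fin.
      have t1 := le_trans n1 nt.
      by rewrite lef_pV2 ?posrE ?pos ?ler1n // homo // ltW.
  - by apply: measurable_funS mg => // t [|]; apply: sub.
  - by move=> t [|] /sub h; apply: g0; have := h _; rewrite /= in_itv /= andbT; apply.
  - apply/disj_setPLR => t /=; rewrite !in_itv /= => /andP[_ tn] /andP[nt _].
    by move: tn; rewrite ltNge nt.
have gfin : (\int[lebesgue_measure]_(t in `[1%R, +oo[) g t)%E \is a fin_num.
  rewrite ge0_fin_numE //; apply: integral_ge0 => t /=; rewrite in_itv /= andbT.
  exact: g0.
set I := fine (\int[lebesgue_measure]_(t in `[1%R, +oo[) g t)%E.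
have Ige n : (0 < n)%N -> \sum_(1 <= i < n) (Psi i.+1%:R)^-1 <= I.
  move=> n0; rewrite -lee_fin fineK //; apply: le_trans (step n n0) _.
  apply: ge0_subset_integral => //; last exact: sub.
  by move=> t /=; rewrite in_itv /= andbT; exact: g0.
have I0 : 0 <= I by have := Ige 1%N isT; rewrite big_geq.
have P1 : 0 <= (Psi 1)^-1 by rewrite invr_ge0 ltW // pos.
exists ((Psi 1)^-1 + I) => -[|[|n]]; [by rewrite big_geq // addr_ge0..|].
rewrite big_ltn // lerD //= big_add1 /=; exact: Ige.
Qed.

(** A time nearly realizing the infimum costs 1, rounding it down to an integer costs at most 1
    more, and the rough triangle inequality adds [2 * delta]. *)
Lemma integer_rays {R : realType} {T : Type} (k : T -> T -> R) (delta : R) :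
  (forall x, k x x = 0) -> (forall x y, k x y = k y x) ->
  (forall x y, 0 <= k x y) -> gromov_delta k delta -> roughly_starlike k ->
  exists w0 K, 0 <= K /\
    forall x, exists g N, integer_ray k w0 g /\ k x (g N) <= K + 2 * delta.
Proof.
move=> kxx k_sym k_ge0 k_delta [w0 [K [K0 star]]].
exists w0, (K + 2); split; first by lra.
move=> x; have [g [g0 gk] infK] := star x.
have hinf : has_inf [set k x (g t) | t in `[0, +oo[].
  split; first by exists (k x (g 0)), 0 => //=; rewrite in_itv /= lexx.
  by exists 0 => _ [t _ <-].
have [u [t /=]] := inf_adherent (@ltr01 R) hinf.
rewrite in_itv /= andbT => t0 <- kt {u}.
exists (fun n => g n%:R), (Num.truncn t); split.
  by split => // i j; rewrite gk.
have /andP[tt tt'] := truncn_itv t0.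
have := rough_triangle kxx k_sym k_delta x (g (Num.truncn t)%:R) (g t).
rewrite gk // ger0_norm ?subr_ge0 //.
by rewrite -natr1 in tt'; lra.
Qed.

Lemma metric_ball_open {R : realType} {T : metricType R} (x : T) (r : R) :
  open (ball x r).
Proof.
rewrite openE => y; rewrite ballEmdist /= => xy.
apply/nbhs_ballP; exists (r - mdist x y) => /=; first by rewrite subr_gt0.
move=> z; rewrite !ballEmdist /= => yz.
by apply: le_lt_trans (metric_triangle x y z) _; lra.
Qed.

(** * Limits in the completion *)

Section completion_limits.
Context {R : realType} {T S : metricType R} (iota : T -> S).
Hypothesis iota_isom : forall x y, mdist (iota x) (iota y) = mdist x y.
Hypothesis boundary_neq0 : metric_boundary iota !=set0.
Hypothesis f_gt0 : forall x, 0 < boundary_dist iota x.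
Hypothesis dense_iota : dense (range iota).
Hypothesis complete_S : forall G : set_system S, ProperFilter G -> cauchy G ->
  exists l : S, G --> l.

Lemma dense_approx (y : S) (e : R) : 0 < e -> exists x, mdist (iota x) y <= e.
Proof.
move=> e0; have : ball y e !=set0 by exists y; exact: ballxx.
move=> /dense_iota /(_ (metric_ball_open _ _))[p [yp [x _ xp]]].
by exists x; move: yp; rewrite -xp ballEmdist /= metric_sym => /ltW.
Qed.

(** Completeness gives the limit. Were it a point [x] of the space, the distance to the boundary
    would stay near its positive value at [x]. *)
Lemma boundary_limit (a : nat -> T) :
  (forall e, 0 < e -> exists N, forall m n, (N <= m)%N -> (N <= n)%N ->
    mdist (a m) (a n) <= e) ->
  (forall e, 0 < e -> exists N, forall n, (N <= n)%N ->
    boundary_dist iota (a n) <= e) ->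
  exists2 y, metric_boundary iota y & forall e, 0 < e ->
    exists N, forall n, (N <= n)%N -> mdist (iota (a n)) y <= e.
Proof.
move=> cau fa.
have cG : cauchy ((iota \o a) n @[n --> \oo]).
  apply: cauchy_exP => e e0; have e2 : 0 < e / 2 by rewrite divr_gt0.
  have [N hN] := cau _ e2; exists (iota (a N)).
  exists N => // n /= Nn; rewrite ballEmdist /= iota_isom.
  by apply: le_lt_trans (hN N n (leqnn _) Nn) _; lra.
have [y ay] := complete_S _ cG.
have lim e : 0 < e -> exists N, forall n, (N <= n)%N -> mdist (iota (a n)) y <= e.
  move=> e0; have := metricType_numDomainType.cvgr_dist_lt ay e0.
  by move=> [N _ hN]; exists N => n Nn; rewrite metric_sym ltW //; exact: hN.
exists y => // -[x _ xy].
have e0 : 0 < boundary_dist iota x / 3 by rewrite divr_gt0.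
have [N1 h1] := fa _ e0; have [N2 h2] := lim _ e0.
have := h1 _ (leq_maxl N1 N2); have := h2 _ (leq_maxr N1 N2).
set n := maxn N1 N2; rewrite -xy iota_isom => d1 d2.
have := boundary_dist_lip iota_isom boundary_neq0 x (a n).
by rewrite metric_sym; have := f_gt0 x; lra.
Qed.

End completion_limits.

(** * Compact balls from Ahlfors regularity *)

Section total_boundedness.
Context {R : realType} {T : pmetricType R}.
Variables (mu : {measure set (borel T) -> \bar R}) (Q : R).
Hypothesis ahl : ahlfors_regular Q mu.
Hypothesis unbounded : (metric_diam T = +oo)%E.

Fixpoint ball_union (e : R) (s : seq T) : set (borel T) :=
  if s is x :: s then (ball x e : set T) `|` ball_union e s else set0.

Lemma ball_unionP e s z : ball_union e s z -> exists2 x, x \in s & mdist x z < e.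
Proof.
elim: s => [//|x s ih] /= [|/ih[y ys yz]].
  by rewrite ballEmdist /= => xz; exists x => //; rewrite inE eqxx.
by exists y => //; rewrite inE ys orbT.
Qed.

Let measurable_ball (x : T) e : measurable (ball x e : set (borel T)).
Proof. by apply: sub_sigma_algebra; exact: metric_ball_open. Qed.

Lemma measurable_ball_union e s : measurable (ball_union e s).
Proof. by elim: s => [|x s ih] /=; [exact: measurable0|exact: measurableU]. Qed.

Lemma separated_ball_measure (C e : R) s : 0 < e ->
  (forall x, (C%:E <= mu (ball x e))%E) ->
  pairwise (fun x y => 2 * e <= mdist x y) s ->
  (((size s)%:R * C)%:E <= mu (ball_union e s))%E.
Proof.
move=> e0 hC; elim: s => [|x s ih] /=; first by rewrite mul0r measure0.
move=> /andP[/allP xs ps]; rewrite measureU //.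
- by rewrite -natr1 mulrDl mul1r addrC EFinD; apply: leeD; [exact: hC|exact: ih].
- exact: measurable_ball_union.
apply/seteqP; split => // z [+ /ball_unionP[y ys yz]].
rewrite ballEmdist /= => xz; have := xs _ ys; have := metric_triangle x z y.
by rewrite (metric_sym z); lra.
Qed.

(** Volume count: without a finite net, separated sequences of any length can be chosen greedily;
    their disjoint balls of radius [e / 2] have measure bounded below and lie in one ball of finite
    measure. Infinite diameter makes the regularity estimates valid at all radii. *)
Lemma finite_net (o : T) (r e : R) : 0 < r -> 0 < e ->
  exists s : seq T, forall x, mdist o x <= r -> exists2 y, y \in s & mdist y x < e.
Proof.
move=> r0 e0; apply: contrapT => hno.
have [C C1 hC] := ahl.
have C0 : 0 < C by exact: lt_le_trans C1.
pose sep := pairwise (fun x y : T => 2 * (e / 2) <= mdist x y).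
have long n : exists s : seq T, [/\ size s = n, sep s &
    forall x, x \in s -> mdist o x <= r].
  elim: n => [|n [s [ss ps os]]]; first by exists [::].
  have /existsNP[x /not_implyP[ox hx]] : ~ forall x, mdist o x <= r ->
      exists2 y, y \in s & mdist y x < e.
    by move=> h; apply: hno; exists s.
  exists (x :: s); split; rewrite /= ?ss //.
    rewrite /sep /= -/sep ps andbT; apply/allP => y ys.
    rewrite mulrC divfK // leNgt metric_sym; apply/negP => h.
    by apply: hx; exists y.
  by move=> y; rewrite inE => /predU1P[->|/os].
have e2 : 0 < e / 2 by rewrite divr_gt0.
have re : 0 < r + e by rewrite addr_gt0.
have big (t : R) : (t%:E < metric_diam T)%E by rewrite unbounded ltry.
pose m := C^-1 * (e / 2) `^ Q.
have m0 : 0 < m by rewrite mulr_gt0 ?invr_gt0 ?powR_gt0.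
have [n hn] := nat_ge (C * (r + e) `^ Q / m + 1).
have [s [ss ps os]] := long n.
have low x : (m%:E <= mu (ball x (e / 2)))%E.
  by have /andP[] := hC x (e / 2) e2 (big _).
have := separated_ball_measure e2 low ps.
apply/negP; rewrite -ltNge.
have /andP[_ up] := hC o (r + e) re (big _).
apply: le_lt_trans (_ : (C * (r + e) `^ Q)%:E < _)%E; last first.
  rewrite lte_fin ss -ltr_pdivrMr //; lra.
apply: le_trans up; apply: le_measure; rewrite ?inE.
- exact: measurable_ball_union.
- exact: measurable_ball.
move=> z /ball_unionP[x xs xz]; rewrite ballEmdist /=.
by have := os _ xs; have := metric_triangle o x z; lra.
Qed.

End total_boundedness.

Section proper_completion.
Context {R : realType} {T : pmetricType R} {S : metricType R} (iota : T -> S).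
Hypothesis iota_isom : forall x y, mdist (iota x) (iota y) = mdist x y.
Hypothesis dense_iota : dense (range iota).
Hypothesis complete_S : forall G : set_system S, ProperFilter G -> cauchy G ->
  exists l : S, G --> l.
Variables (mu : {measure set (borel T) -> \bar R}) (Q : R).
Hypothesis ahl : ahlfors_regular Q mu.
Hypothesis unbounded : (metric_diam T = +oo)%E.

Lemma closed_metric_ball (o : S) (r : R) : closed [set z | mdist o z <= r].
Proof.
rewrite -openC openE => z /= /negP; rewrite -ltNge => oz.
apply/nbhs_ballP; exists (mdist o z - r) => /=; first by rewrite subr_gt0.
move=> y; rewrite ballEmdist /= => zy; apply/negP; rewrite -ltNge.
by have := metric_triangle o y z; rewrite (metric_sym y); lra.
Qed.

(** An ultrafilter on the ball contains one of the finitely many small balls covering it, for every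
    size, so it is Cauchy and converges. *)
Lemma compact_metric_ball (o : T) (r : R) : 0 < r ->
  compact [set z | mdist (iota o) z <= r].
Proof.
move=> r0; rewrite compact_ultra => G UG GK.
have cG : cauchy G.
  apply: cauchy_exP => e e0; have e2 : 0 < e / 2 by rewrite divr_gt0.
  have re : 0 < r + e / 2 by rewrite addr_gt0.
  have [s hs] := finite_net ahl unbounded o re e2.
  apply: contrapT => /forallNP no.
  have : G (\bigcap_(y in [set` s]) ~` ball (iota y) e).
    elim: {hs} s => [|y s ih].
      by apply: filterS filterT => z _ y.
    have Gy : G (~` ball (iota y) e).
      by have [/no|] := in_ultra_setVsetC (ball (iota y) e) UG.
    apply: filterS (filterI Gy ih) => z [zy zs] x /=.
    by rewrite inE => /predU1P[->|/zs].
  move=> /(filterI GK)/filter_ex[z /= [oz hz]].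
  have [x xz] := dense_approx dense_iota z e2.
  have [|y ys yx] := hs x.
    rewrite -iota_isom; have := metric_triangle (iota o) z (iota x).
    by rewrite (metric_sym z); lra.
  apply: (hz y ys); rewrite ballEmdist /=.
  have := metric_triangle (iota y) (iota x) z; rewrite iota_isom; lra.
have [l Gl] := complete_S _ cG.
exists l; split => //.
have /closure_id -> := @closed_metric_ball (iota o) r.
by move=> U lU; have GU : G U := Gl _ lU; exact: filter_ex (filterI GK GU).
Qed.

End proper_completion.

(** * From weight estimates to the boundary homeomorphism *)

Section uniform_boundary.
Context {R : realType} {T : Type} (k : T -> T -> R) (F : T -> R) (E psi : R -> R).
Variables (delta eps L D t0 S C : R) (w : T).
Context {X : topologicalType} (j : T -> X) (q : X -> X -> R).
Local Notation B := (~` range j).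
Hypothesis kxx : forall x, k x x = 0.
Hypothesis k_ge0 : forall x y, 0 <= k x y.
Hypothesis k_sym : forall x y, k x y = k y x.
Hypothesis k_delta : gromov_delta k delta.
Hypothesis starlike : roughly_starlike k.
Hypothesis delta0 : 0 <= delta.
Hypothesis eps0 : 0 < eps.
Hypothesis eps_delta : eps * (5 * delta) < 1.
Hypothesis L1 : 1 <= L.
Hypothesis C1 : 1 <= C.
Hypothesis q_ge0 : forall x y, 0 <= q x y.
Hypothesis q_sym : forall x y, q x y = q y x.
Hypothesis q_eq0 : forall x y, q x y = 0 -> x = y.
Hypothesis q_chain : forall (p : nat -> X) n,
  q (p 0) (p n) <= L * \sum_(0 <= i < n) q (p i) (p i.+1).
Hypothesis F_gt0 : forall x, 0 < F x.
Hypothesis E_homo : forall s t, s <= t -> E s <= E t.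
Hypothesis qE : forall x y, q (j x) (j y) <= F x * E (k x y).
Hypothesis FE : forall x y, F y <= F x * E (k x y).
Hypothesis q_uniform : forall x y, t0 <= k x y ->
  psi (k x y) * Num.min (F x) (F y) <= 2 * q (j x) (j y).
Hypothesis qD : forall x y, q (j x) (j y) <= D.
Hypothesis psi_homo : forall s t, 1 <= s -> s <= t -> psi s <= psi t.
Hypothesis psi_gt0 : forall s, 1 <= s -> 0 < psi s.
Hypothesis psi_ge0 : forall s, 0 <= s -> 0 <= psi s.
Hypothesis psi_sum : forall n, \sum_(1 <= i < n) (psi i%:R)^-1 <= S.
Hypothesis q_complete : forall a : nat -> T,
  (forall e, 0 < e -> exists N, forall m n, (N <= m)%N -> (N <= n)%N ->
    q (j (a m)) (j (a n)) <= e) ->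
  (forall e, 0 < e -> exists N, forall n, (N <= n)%N -> F (a n) <= e) ->
  exists2 y, B y & forall e, 0 < e ->
    exists N, forall n, (N <= n)%N -> q (j (a n)) y <= e.
Hypothesis q_dense : forall y, B y -> forall e, 0 < e -> exists x, q (j x) y <= e.
Hypothesis F_le : forall x y, B y -> F x <= C * q (j x) y.
Hypothesis nbhs_q : forall y U, B y -> nbhs y U ->
  exists2 r, 0 < r & forall z, B z -> q y z <= r -> U z.
Hypothesis q_nbhs : forall y r, B y -> 0 < r ->
  exists2 U, nbhs y U & forall z, B z -> U z -> q y z <= r.

(** The weight estimates are based at the starlikeness center [w0], the Gromov boundary at the given
    [w]; changing the base point alters products by a bounded amount. *)
Theorem uniform_boundary_homeomorphic :
  homeomorphic (gromov_boundary k w eps) (set_type B).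
Proof.
have [w0 [K0 [K00 rays0]]] := integer_rays kxx k_sym k_ge0 k_delta starlike.
set K := K0 + 2 * delta in rays0.
have K_ge0 : 0 <= K by rewrite /K; move: delta0; lra.
pose qT x y := q (j x) (j y).
have qT_chain (p : nat -> T) n :
    qT (p 0) (p n) <= L * \sum_(0 <= i < n) qT (p i) (p i.+1).
  exact: (q_chain (j \o p)).
have qT_ge0 x y : 0 <= qT x y by exact: q_ge0.
have qT_sym x y : qT x y = qT y x by exact: q_sym.
have base u v x y : gromov_product k u x y <=
    gromov_product k v x y + k u v + 2 * delta.
  exact: (gromov_product_base kxx k_sym k_delta).
apply: (@gromov_boundary_homeomorphic R T k delta eps w _ _ _ _ _ _ X j q F L C)
  => //.
- move=> x y z.
  have := q_chain (fun i => if i is 0 then x else if i is 1 then y else z) 2.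
  by rewrite /= !big_nat_recl //= big_nil addr0.
- move=> e e0.
  have [M hM] : exists M, forall x, M <= k x w0 -> F x <= e.
    exact: (weight_small w0 delta0 L1 qT_ge0 F_gt0 q_uniform qD psi_homo psi_gt0
      psi_sum K_ge0 e0).
  exists (M + k w w0 + 2 * delta) => x hx; apply: hM.
  have := base w w0 x x; rewrite {2}/gromov_product kxx; lra.
- move=> e e0; have [M hM] := quasimetric_small_of_product kxx k_ge0 k_sym delta0
    k_delta L1 qT_ge0 qT_sym qT_chain F_gt0 E_homo qE FE q_uniform qD psi_homo
    psi_gt0 psi_sum K_ge0 rays0 e0.
  exists (M + k w w0 + 2 * delta) => x y hx; apply: hM.
  have := base w w0 x y; lra.
move=> M; have [r r0 hr] := product_large_of_small kxx k_ge0 k_sym delta0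
    k_delta L1 qT_ge0 qT_sym qT_chain F_gt0 E_homo qE FE q_uniform qD psi_homo
    psi_gt0 psi_ge0 psi_sum K_ge0 rays0 (M + k w0 w + 2 * delta).
exists r => // x y Fx Fy qr; have := hr x y Fx Fy qr; have := base w0 w x y; lra.
Qed.

End uniform_boundary.

(** * Sphericalization of a metric space *)

Section sphericalization.
Context {R : realType} {S : metricType R} (o : S).
Implicit Types u v : option S.

Definition conformal_factor u : R :=
  if u is Some x then (1 + mdist o x)^-1 else 0.

Local Notation h := conformal_factor.

(** The clauses for [None] are the limits at infinity: [mdist x y * h (Some y)] tends to 1 as [y]
    leaves all balls. *)
Definition spherical_dist u v : R :=
  match u, v with
  | Some x, Some y => mdist x y * h u * h v
  | Some _, None => h u
  | None, Some _ => h v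
  | None, None => 0
  end.

Local Notation q := spherical_dist.

Let rho_ge0 x : 0 <= mdist o x. Proof. exact: mdist_ge0. Qed.
Let rho1_gt0 x : 0 < 1 + mdist o x.
Proof. by rewrite ltr_wpDr. Qed.

Lemma conformal_factor_gt0 x : 0 < h (Some x).
Proof. by rewrite invr_gt0. Qed.

Lemma conformal_factor_ge0 u : 0 <= h u.
Proof. by case: u => [x|] //=; rewrite invr_ge0 ltW. Qed.

Lemma conformal_factor_le1 u : h u <= 1.
Proof. by case: u => [x|] //=; rewrite invf_le1 // lerDl. Qed.

Lemma spherical_dist_ge0 u v : 0 <= q u v.
Proof.
case: u v => [x|] [y|] //=; rewrite ?invr_ge0 ?(ltW (rho1_gt0 _)) //.
by rewrite !mulr_ge0 ?mdist_ge0 // invr_ge0 ltW.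
Qed.

Lemma spherical_dist_sym u v : q u v = q v u.
Proof. by case: u v => [x|] [y|] //=; rewrite metric_sym mulrAC. Qed.

Lemma spherical_dist_eq0 u v : q u v = 0 -> u = v.
Proof.
case: u v => [x|] [y|] //= /eqP; last first.
- by rewrite invr_eq0 gt_eqF.
- by rewrite invr_eq0 gt_eqF.
by rewrite !mulf_eq0 !invr_eq0 !(gt_eqF (rho1_gt0 _)) !orbF => /eqP/mdist_positivity ->.
Qed.

Lemma spherical_dist_le u v : q u v <= h u + h v.
Proof.
case: u v => [x|] [y|] /=; rewrite ?addr0 ?add0r //.
have hx := conformal_factor_gt0 x; have hy := conformal_factor_gt0 y.
rewrite /= in hx hy.
have ex : (1 + mdist o x) * (1 + mdist o x)^-1 = 1 by rewrite divff // gt_eqF.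
have ey : (1 + mdist o y) * (1 + mdist o y)^-1 = 1 by rewrite divff // gt_eqF.
have := metric_triangle x o y; rewrite (metric_sym x o) => t.
set a := (1 + mdist o x)^-1 in hx ex *; set b := (1 + mdist o y)^-1 in hy ey *.
have ab : 0 < a * b by exact: mulr_gt0.
have : mdist x y * (a * b) <= (mdist o x + mdist o y) * (a * b) by rewrite ler_pM2r.
have -> : (mdist o x + mdist o y) * (a * b) =
  ((1 + mdist o x) * a) * b + ((1 + mdist o y) * b) * a - 2 * (a * b) by ring.
by rewrite ex ey; lra.
Qed.

Lemma conformal_factor_lip u v : h u <= h v + q u v.
Proof.
case: u v => [x|] [y|] /=; rewrite ?addr0 ?add0r //; last first.
  by rewrite addr_ge0 ?invr_ge0 ?ltW.
have ex : (1 + mdist o x) * (1 + mdist o x)^-1 = 1 by rewrite divff // gt_eqF.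
have ey : (1 + mdist o y) * (1 + mdist o y)^-1 = 1 by rewrite divff // gt_eqF.
have hx := conformal_factor_gt0 x; have hy := conformal_factor_gt0 y.
rewrite /= in hx hy.
have := metric_triangle o x y => t.
set a := (1 + mdist o x)^-1 in hx ex *; set b := (1 + mdist o y)^-1 in hy ey *.
have ab : 0 < a * b by exact: mulr_gt0.
have : (1 + mdist o y) * (a * b) <= (1 + mdist o x + mdist x y) * (a * b).
  by rewrite ler_pM2r //; lra.
have -> : (1 + mdist o y) * (a * b) = ((1 + mdist o y) * b) * a by ring.
have -> : (1 + mdist o x + mdist x y) * (a * b) =
  ((1 + mdist o x) * a) * b + mdist x y * a * b by ring.
by rewrite ex ey; lra.
Qed.

(** Let [m] be the larger conformal factor of the two ends. If [m <= 2 * s], the bound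
    [q u v <= h u + h v] suffices. Otherwise all factors along the chain are at least [m / 2], as
    [h] is 1-Lipschitz for [q]; the chain avoids infinity and the triangle inequality of [mdist]
    applies. Both cases give the constant 4. *)
Lemma spherical_dist_chain (p : nat -> option S) n :
  q (p 0) (p n) <= 4 * \sum_(0 <= i < n) q (p i) (p i.+1).
Proof.
set s := \sum_(0 <= i < n) _.
have s0 : 0 <= s by apply: sumr_ge0 => i _; exact: spherical_dist_ge0.
pose d u v := if u is Some x then if v is Some y then mdist x y else 0 else 0.
have up i : (i <= n)%N -> h (p 0) <= h (p i) + s /\ h (p n) <= h (p i) + s.
  have sub m m' : (m <= m')%N -> (m' <= n)%N -> h (p m) <= h (p m') + s /\
      h (p m') <= h (p m) + s.
    move=> mm m'n.
    have part : \sum_(m <= i < m') q (p i) (p i.+1) <= s.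
      rewrite /s (big_cat_nat (leq0n m) (leq_trans mm m'n)) /=.
      rewrite (big_cat_nat mm m'n) /= ler_wpDl ?ler_wpDr ?sumr_ge0 // => *;
        exact: spherical_dist_ge0.
    suff : h (p m) <= h (p m') + \sum_(m <= i < m') q (p i) (p i.+1) /\
        h (p m') <= h (p m) + \sum_(m <= i < m') q (p i) (p i.+1).
      by case; split; lra.
    elim: m' mm {m'n part} => [|m' ih].
      by rewrite leqn0 => /eqP ->; rewrite big_geq ?addr0.
    rewrite leq_eqVlt => /predU1P[->|mm]; first by rewrite big_geq ?addr0.
    have [h1 h2] := ih mm; rewrite big_nat_recr //=.
    have := conformal_factor_lip (p m') (p m'.+1).
    have := conformal_factor_lip (p m'.+1) (p m').
    by rewrite (spherical_dist_sym (p m'.+1)); split; lra.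
  by move=> hi; split; [case: (sub 0 i)|case: (sub i n)].
pose m := Num.max (h (p 0)) (h (p n)).
have [m1 m2] : h (p 0) <= m /\ h (p n) <= m by rewrite !le_max !lexx orbT.
have [ms|sm] := leP m (2 * s).
  by have := spherical_dist_le (p 0) (p n); lra.
have low i : (i <= n)%N -> m / 2 <= h (p i).
  move=> /up[u1 u2]; have : m <= h (p i) + s by rewrite ge_max u1.
  lra.
have m0 : 0 < m by lra.
have fin i : (i <= n)%N -> p i <> None.
  by move=> /low hi pi; rewrite pi /= in hi; lra.
have qd u v : u <> None -> v <> None -> q u v = d u v * h u * h v.
  by case: u v => [x|] [y|].
have tri : d (p 0) (p n) <= \sum_(0 <= i < n) d (p i) (p i.+1).
  elim: n fin {s s0 up m m1 m2 sm low m0} => [|n ih] fin.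
    by rewrite big_geq //=; case: (p 0) => //= x; rewrite mdistxx.
  rewrite big_nat_recr //=; apply: le_trans (_ : d (p 0) (p n) + d (p n) (p n.+1) <= _).
    have := fin n.+1 (leqnn _); have := fin n (leqnSn _); have := fin 0 (leq0n _).
    case: (p 0) (p n) (p n.+1) => [x|] [y|] [z|] //= _ _ _; exact: metric_triangle.
  by rewrite lerD2r; apply: ih => i hi; apply: fin; exact: leqW.
have d0 u v : 0 <= d u v by case: u v => [x|] [y|] //=; exact: mdist_ge0.
have m22 : 0 < m / 2 by rewrite divr_gt0.
have dq : \sum_(0 <= i < n) d (p i) (p i.+1) * (m / 2 * (m / 2)) <= s.
  rewrite /s ler_sum_nat // => i hi.
  have i1 : (i <= n)%N by clear -hi; lia.
  have i2 : (i.+1 <= n)%N by clear -hi; lia.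
  rewrite qd; [|exact: fin..]; rewrite -[leRHS]mulrA ler_wpM2l //.
  by apply: ler_pM; rewrite ?low // ltW.
rewrite qd; [|exact: fin..].
apply: le_trans (_ : d (p 0) (p n) * (m * m) <= _).
  by rewrite -mulrA ler_wpM2l // ler_pM // conformal_factor_ge0.
apply: le_trans (_ : (\sum_(0 <= i < n) d (p i) (p i.+1)) * (m * m) <= _).
  by rewrite ler_wpM2r // mulr_ge0 // ltW.
move: dq; rewrite -mulr_suml.
have -> : m / 2 * (m / 2) = m * m / 4 by field.
lra.
Qed.

End sphericalization.

(** * The bounded and the unbounded case *)

Section uniform_spaces.
Context {R : realType} {Omega : pmetricType R} {Omegabar : metricType R}.
Variables (iota : Omega -> Omegabar) (c : R) (phi psi : R -> R) (delta eps : R).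
Hypothesis iota_isom : forall x y, mdist (iota x) (iota y) = mdist x y.
Hypothesis dense_iota : dense (range iota).
Hypothesis complete_bar : forall G : set_system Omegabar,
  ProperFilter G -> cauchy G -> exists l : Omegabar, G --> l.
Hypothesis lcO : locally_compact [set: Omega].
Hypothesis qcO : quasiconvex Omega c.
Hypothesis boundary_neq0 : metric_boundary iota !=set0.
Hypothesis phi_psi : nneg_homeo phi psi.
Hypothesis starlike : roughly_starlike (quasihyperbolic iota).
Hypothesis uniform : phi_uniform iota phi.
Hypothesis delta0 : 0 <= delta.
Hypothesis k_delta : gromov_delta (quasihyperbolic iota) delta.
Hypothesis eps0 : 0 < eps.
Hypothesis eps_delta : eps * (5 * delta) < 1.
Local Notation k := (quasihyperbolic iota).
Local Notation f := (boundary_dist iota).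

Let f_gt0 : forall x, 0 < f x.
Proof. exact: boundary_dist_gt0. Qed.

Let kxx x : k x x = 0.
Proof. exact: (quasihyperbolicxx iota_isom boundary_neq0 f_gt0 qcO). Qed.

Let k_ge0 x y : 0 <= k x y.
Proof. exact: (quasihyperbolic_ge0 iota_isom boundary_neq0 f_gt0 qcO). Qed.

Let k_sym x y : k x y = k y x.
Proof. exact: (quasihyperbolic_sym iota_isom boundary_neq0 f_gt0). Qed.

Let k_dist x y : mdist x y <= f x * (expR (k x y) - 1).
Proof. exact: (quasihyperbolic_dist iota_isom boundary_neq0 f_gt0 qcO). Qed.

Let k_f x y : f y <= f x * expR (k x y).
Proof. exact: (quasihyperbolic_boundary_dist iota_isom boundary_neq0 f_gt0 qcO). Qed.

Let psi_homo s t : 0 <= s -> s <= t -> psi s <= psi t.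
Proof. exact: (nneg_homeo_homo_le phi_psi). Qed.

Let psi_gt0 t : 0 < t -> 0 < psi t.
Proof. exact: (nneg_homeo_gt0 phi_psi). Qed.

Let psi_ge0 t : 0 <= t -> 0 <= psi t.
Proof. by move=> t0; case: phi_psi => _ /(_ t t0)[]. Qed.

Let psi_continuous : {within `[1, +oo[, continuous psi}.
Proof.
case: phi_psi => _ _ _; apply: continuous_subspaceW => t /=.
by rewrite !in_itv /= !andbT; apply: le_trans.
Qed.

Lemma uniform_psi x y : psi (k x y) * Num.min (f x) (f y) <= mdist x y.
Proof.
have m0 : 0 < Num.min (f x) (f y) by rewrite lt_min !f_gt0.
rewrite -ler_pdivlMr //.
have d0 : 0 <= mdist x y / Num.min (f x) (f y) by rewrite divr_ge0 ?mdist_ge0 // ltW.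
have [phiK _ _ _] := phi_psi; rewrite -[leRHS](phiK _ d0).2.
exact: psi_homo.
Qed.

Lemma bounded_boundary_homeomorphic (w : Omega) :
  (metric_diam Omega < +oo)%E ->
  (\int[lebesgue_measure]_(t in `[1%R, +oo[) ((psi t)^-1)%:E < +oo)%E ->
  homeomorphic (gromov_boundary k w eps) (set_type (metric_boundary iota)).
Proof.
move=> bounded int_psi.
have psi1_homo s t : 1 <= s -> s <= t -> psi s <= psi t.
  by move=> s1; apply: psi_homo; exact: le_trans s1.
have psi1_gt0 s : 1 <= s -> 0 < psi s.
  by move=> s1; apply: psi_gt0; exact: lt_le_trans s1.
have [S hS] := sum_le_integral psi1_homo psi1_gt0 psi_continuous int_psi.
have le_diam (x y : Omega) : mdist x y <= fine (metric_diam Omega).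
  rewrite -lee_fin fineK.
    by apply: ereal_sup_ubound; exists (x, y).
  rewrite ge0_fin_numE //; apply: le_trans (_ : (mdist x y)%:E <= _)%E.
    by rewrite lee_fin mdist_ge0.
  by apply: ereal_sup_ubound; exists (x, y).
apply: (@uniform_boundary_homeomorphic R Omega k f expR psi delta eps 1
  (fine (metric_diam Omega)) 0 S 1 w Omegabar iota (@mdist R Omegabar)) => //.
- exact: mdist_ge0.
- exact: metric_sym.
- exact: mdist_positivity.
- move=> p n; rewrite mul1r; elim: n => [|n ih]; first by rewrite big_geq // mdistxx.
  rewrite big_nat_recr //=; apply: le_trans (metric_triangle _ (p n) _) _.
  by rewrite lerD2r.
- by move=> s t st; rewrite ler_expR.
- move=> x y; rewrite iota_isom; apply: le_trans (k_dist x y) _.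
  by rewrite ler_pM2l // gerBl.
- move=> x y _; rewrite iota_isom; apply: le_trans (uniform_psi x y) _.
  by have := mdist_ge0 x y; lra.
- by move=> x y; rewrite iota_isom.
- move=> a cau; apply: (boundary_limit iota_isom boundary_neq0 f_gt0 complete_bar).
  by move=> e /cau[N hN]; exists N => m n Nm Nn; rewrite -iota_isom; exact: hN.
- by move=> y _ e e0; exact: dense_approx.
- by move=> x y By; rewrite mul1r; exact: boundary_dist_le.
- move=> y U _ /nbhs_ballP[r /= r0 rU]; exists (r / 2); first by rewrite divr_gt0.
  by move=> z _ yz; apply: rU; rewrite ballEmdist /=; lra.
- move=> y r _ r0; exists (ball y r); first exact: nbhsx_ballx.
  by move=> z _; rewrite ballEmdist /= => /ltW.
Qed.

Section unbounded.
Variable o : Omega.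
Local Notation h x := (conformal_factor (iota o) (Some (iota x))).
Local Notation q := (spherical_dist (iota o)).
Local Notation F x := (f x * h x ^+ 2).
(** Both the value of [f] at [o] and its slope 1 have to be dominated, hence the maximum. *)
Let F0 := Num.max 1 (f o).

Let h_gt0 x : 0 < h x. Proof. exact: conformal_factor_gt0. Qed.
Let hE x : h x = (1 + mdist o x)^-1. Proof. by rewrite /= iota_isom. Qed.

Let h1 x : h x * (1 + mdist o x) = 1.
Proof. by rewrite hE mulVf // gt_eqF // ltr_wpDr // mdist_ge0. Qed.

Let F0_ge1 : 1 <= F0. Proof. by rewrite le_max lexx. Qed.

Lemma boundary_dist_growth x : f x <= F0 * (1 + mdist o x).
Proof.
have := boundary_dist_lip iota_isom boundary_neq0 x o.
have : f o <= F0 by rewrite le_max lexx orbT.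
have : mdist o x <= F0 * mdist o x by rewrite ler_peMl // mdist_ge0.
by rewrite (metric_sym x); lra.
Qed.

Lemma weight_le_conformal x : F x <= F0 * h x.
Proof.
have := ler_wpM2r (ltW (mulr_gt0 (h_gt0 x) (h_gt0 x))) (boundary_dist_growth x).
have -> : F0 * (1 + mdist o x) * (h x * h x) = F0 * h x * (h x * (1 + mdist o x)).
  by ring.
by rewrite h1 mulr1 expr2.
Qed.

(** A Harnack inequality: the distance to [o] changes by at most [f y * expR (k x y)], and [f y]
    grows at most linearly in [mdist o y]. *)
Lemma conformal_factor_ratio x y : h y <= h x * (1 + F0 * expR (k x y)).
Proof.
have hx := h_gt0 x; have hy := h_gt0 y; have dy := mdist_ge0 o y.
have fy := boundary_dist_growth y.
have : 1 + mdist o x <= (1 + mdist o y) * (1 + F0 * expR (k x y)).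
  have := k_dist y x; rewrite k_sym => kd.
  have E0 := expR_gt0 (k x y).
  have : f y * (expR (k x y) - 1) <= F0 * (1 + mdist o y) * expR (k x y).
    apply: le_trans (_ : f y * expR (k x y) <= _); last by rewrite ler_pM2r.
    by rewrite ler_pM2l // gerBl.
  by have := metric_triangle o y x; lra.
move=> /(ler_wpM2l (ltW (mulr_gt0 hx hy))).
have -> : h x * h y * (1 + mdist o x) = h y * (h x * (1 + mdist o x)) by ring.
have -> : h x * h y * ((1 + mdist o y) * (1 + F0 * expR (k x y))) =
  h x * (1 + F0 * expR (k x y)) * (h y * (1 + mdist o y)) by ring.
by rewrite !h1 !mulr1.
Qed.

(** One exponential for [f], and one factor [1 + F0 * expR t] for each of the two conformal factors
    in the weight. *)
Let E (t : R) := expR t * (1 + F0 * expR t) ^+ 2.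

Let E_homo s t : s <= t -> E s <= E t.
Proof.
move=> st; have est : expR s <= expR t by rewrite ler_expR.
have s0 := expR_gt0 s.
have F00 : 0 < F0 by exact: lt_le_trans F0_ge1.
have g0 : 0 < F0 * expR s by exact: mulr_gt0.
have gst : F0 * expR s <= F0 * expR t by rewrite ler_pM2l.
apply: ler_pM; rewrite ?expR_ge0 ?sqr_ge0 //.
by rewrite ler_pXn2r ?nnegrE //; lra.
Qed.

Let G_ge1 x y : 1 <= 1 + F0 * expR (k x y).
Proof. by rewrite lerDl mulr_ge0 ?expR_ge0 // (le_trans _ F0_ge1). Qed.

Lemma spherical_dist_iota x y :
  q (Some (iota x)) (Some (iota y)) = mdist x y * h x * h y.
Proof. by rewrite /spherical_dist iota_isom. Qed.

Lemma spherical_dist_expR x y : q (Some (iota x)) (Some (iota y)) <= F x * E (k x y).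
Proof.
rewrite spherical_dist_iota /E; have G1 := G_ge1 x y; have e0 := expR_gt0 (k x y).
set G := 1 + _ in G1 *; have rat : h y <= h x * G := conformal_factor_ratio x y.
have hx := h_gt0 x; have hy := h_gt0 y; have fx := f_gt0 x.
have kd : mdist x y <= f x * expR (k x y).
  by apply: le_trans (k_dist x y) _; rewrite ler_pM2l // gerBl.
apply: le_trans (_ : f x * expR (k x y) * h x * (h x * G) <= _).
  have d0 := mdist_ge0 x y.
  apply: ler_pM => //; [by rewrite mulr_ge0 // ltW|exact: ltW|by rewrite ler_pM2r].
have -> : f x * expR (k x y) * h x * (h x * G) =
  f x * h x ^+ 2 * (expR (k x y) * G) by ring.
rewrite ler_pM2l ?mulr_gt0 ?exprn_gt0 // ler_pM2l // expr2 ler_peMl //; lra.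
Qed.

Lemma spherical_weight_expR x y : F y <= F x * E (k x y).
Proof.
rewrite /E; have G1 := G_ge1 x y; have e0 := expR_gt0 (k x y).
set G := 1 + _ in G1 *; have rat : h y <= h x * G := conformal_factor_ratio x y.
have hx := h_gt0 x; have hy := h_gt0 y; have fx := f_gt0 x.
have -> : F x * (expR (k x y) * G ^+ 2) = f x * expR (k x y) * (h x * G) ^+ 2 by ring.
apply: ler_pM; [exact: ltW|exact: sqr_ge0|exact: k_f|].
by rewrite ler_pXn2r ?nnegrE ?mulr_ge0 ?(ltW hx) ?(ltW hy) //; lra.
Qed.

(* sqrt psi appears because a minimum is at most a geometric mean, and the
   conformal factors enter the geometric mean of the weights symmetrically. *)
Lemma spherical_uniform x y : phi 1 <= k x y ->
  Num.sqrt (psi (k x y)) * Num.min (F x) (F y) <=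
  2 * q (Some (iota x)) (Some (iota y)).
Proof.
have [phiK _ _ _] := phi_psi; have [p0 p1] := phiK 1 ler01.
move=> k1; have ps1 : 1 <= psi (k x y) by rewrite -p1; exact: psi_homo.
have um := uniform_psi x y.
have fx := f_gt0 x; have fy := f_gt0 y; have hx := h_gt0 x; have hy := h_gt0 y.
have d0 := mdist_ge0 x y.
rewrite spherical_dist_iota.
set m := Num.min (F x) (F y).
have m0 : 0 < m by rewrite lt_min !mulr_gt0 ?exprn_gt0.
have ps0 : 0 <= psi (k x y) by lra.
rewrite -(@ler_pXn2r _ 2) ?nnegrE ?mulr_ge0 ?sqrtr_ge0 ?(ltW hx) ?(ltW hy) ?(ltW m0) //.
rewrite exprMn sqr_sqrtr //.
have mm : m ^+ 2 <= F x * F y.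
  rewrite expr2; apply: ler_pM; rewrite ?(ltW m0) ?ge_min ?lexx ?orbT //.
apply: le_trans (ler_wpM2l ps0 mm) _.
(* The threshold [phi 1] gives [psi (k x y) >= 1], so the smaller boundary distance is at most
   [mdist x y] and the larger one at most twice that. *)
have fxy : psi (k x y) * (f x * f y) <= 2 * mdist x y ^+ 2.
  have l1 := boundary_dist_lip iota_isom boundary_neq0 x y.
  have l2 := boundary_dist_lip iota_isom boundary_neq0 y x.
  rewrite (metric_sym y) in l2.
  wlog le_xy : x y fx fy hx hy d0 um l1 l2 ps1 ps0 {k1 m m0 mm} / f x <= f y.
    move=> W; have [xy|/ltW yx] := leP (f x) (f y); first exact: W.
    rewrite k_sym (metric_sym x) (mulrC (f x)).
    apply: W => //; rewrite ?(k_sym y) ?(metric_sym y) //.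
    by rewrite minC.
  rewrite (min_idPl le_xy) in um.
  have fd : f x <= mdist x y.
    by apply: le_trans um; rewrite ler_peMl // ltW.
  have fyd : f y <= 2 * mdist x y by lra.
  have -> : 2 * mdist x y ^+ 2 = mdist x y * (2 * mdist x y) by ring.
  by rewrite mulrA; apply: ler_pM; rewrite ?mulr_ge0 // ltW.
have hh : 0 < (h x * h y) ^+ 2 by rewrite exprn_gt0 // mulr_gt0.
have := ler_wpM2r (ltW hh) fxy.
have -> : psi (k x y) * (f x * f y) * (h x * h y) ^+ 2 = psi (k x y) * (F x * F y).
  by ring.
move=> /le_trans; apply.
have -> : (2 * (mdist x y * h x * h y)) ^+ 2 =
  2 * (2 * mdist x y ^+ 2 * (h x * h y) ^+ 2) by ring.
have : 0 <= 2 * mdist x y ^+ 2 * (h x * h y) ^+ 2.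
  by rewrite mulr_ge0 ?sqr_ge0 // mulr_ge0 ?sqr_ge0.
by lra.
Qed.

(** While [h x] is at most twice the factor at [u], this reduces to [f x <= mdist (iota x) z].
    Otherwise [q] is at least [h x / 2], which dominates the weight; the point at infinity is of the
    second kind. *)
Lemma weight_le_spherical x (u : option Omegabar) : ~ range (Some \o iota) u ->
  F x <= 2 * F0 * q (Some (iota x)) u.
Proof.
move=> Bu; have hx := h_gt0 x; have F00 := F0_ge1.
have Fh := weight_le_conformal x.
case: u Bu => [z|] Bz; last first.
  rewrite [q _ _]/= -/(h x); apply: le_trans Fh _.
  by rewrite -mulrA ler_peMl ?ler1n // mulr_ge0 ?ltW //; lra.
have Bz' : metric_boundary iota z.
  by move=> [y _ yz]; apply: Bz; exists y => //=; rewrite yz.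
have fz := boundary_dist_le boundary_neq0 x Bz'.
have lip := conformal_factor_lip (iota o) (Some (iota x)) (Some z).
have q0 := spherical_dist_ge0 (iota o) (Some (iota x)) (Some z).
set hz := conformal_factor (iota o) (Some z) in lip.
have hz0 : 0 < hz by exact: conformal_factor_gt0.
have [le2|lt2] := leP (h x) (2 * hz).
  apply: le_trans (_ : 2 * q (Some (iota x)) (Some z) <= _); last first.
    by rewrite ler_wpM2r // ler_peMr.
  have -> : q (Some (iota x)) (Some z) = mdist (iota x) z * h x * hz by [].
  have -> : 2 * (mdist (iota x) z * h x * hz) = mdist (iota x) z * (h x * (2 * hz)).
    by ring.
  apply: ler_pM; rewrite ?sqr_ge0 ?(ltW (f_gt0 _)) // expr2 ler_pM2l //.
apply: le_trans Fh _; rewrite -mulrA mulrCA ler_wpM2l //; lra.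
Qed.

(** Either the conformal factor tends to 0 and the sequence tends to infinity, or it is bounded
    below from some index on; there [q] controls [mdist] and the limit is found in the
    completion. *)
Lemma spherical_complete (a : nat -> Omega) :
  (forall e, 0 < e -> exists N, forall m n, (N <= m)%N -> (N <= n)%N ->
    q (Some (iota (a m))) (Some (iota (a n))) <= e) ->
  (forall e, 0 < e -> exists N, forall n, (N <= n)%N -> F (a n) <= e) ->
  exists2 u, (~` range (Some \o iota)) u & forall e, 0 < e ->
    exists N, forall n, (N <= n)%N -> q (Some (iota (a n))) u <= e.
Proof.
move=> cau Fa.
have [h0|] := pselect (forall e, 0 < e -> exists N, forall n, (N <= n)%N -> h (a n) <= e).
  by exists None => // -[].
move=> /existsNP[e0 /not_implyP[e00 hno]].
have e2 : 0 < e0 / 2 by rewrite divr_gt0.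
have [N0 hN0] := cau _ e2.
have [n0 [N0n0 hn0]] : exists n, (N0 <= n)%N /\ e0 < h (a n).
  apply: contrapT => H; apply: hno; exists N0 => n Nn; rewrite leNgt; apply/negP => hn.
  by apply: H; exists n.
have low n : (N0 <= n)%N -> e0 / 2 <= h (a n).
  move=> Nn; have := hN0 n0 n N0n0 Nn.
  have := conformal_factor_lip (iota o) (Some (iota (a n0))) (Some (iota (a n))).
  by lra.
have [||y By ay] := boundary_limit iota_isom boundary_neq0 f_gt0 complete_bar (a := a).
- move=> e epos.
  have [N hN] := cau (e * (e0 / 2 * (e0 / 2))) (mulr_gt0 epos (mulr_gt0 e2 e2)).
  exists (maxn N N0) => m n; rewrite !geq_max => /andP[Nm N0m] /andP[Nn N0n].
  rewrite -(@ler_pM2r _ (e0 / 2 * (e0 / 2))) ?mulr_gt0 //.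
  apply: le_trans (hN m n Nm Nn); rewrite spherical_dist_iota -[leRHS]mulrA.
  rewrite ler_wpM2l ?mdist_ge0 //.
  by apply: ler_pM; rewrite ?low // ltW.
- move=> e epos.
  have [N hN] := Fa (e * (e0 / 2) ^+ 2) (mulr_gt0 epos (exprn_gt0 _ e2)).
  exists (maxn N N0) => n; rewrite !geq_max => /andP[Nn N0n].
  rewrite -(@ler_pM2r _ ((e0 / 2) ^+ 2)) ?exprn_gt0 //.
  apply: le_trans (hN n Nn); rewrite ler_wpM2l ?(ltW (f_gt0 _)) //.
  by rewrite ler_pXn2r ?nnegrE ?low // ltW.
exists (Some y).
  by move=> [x _ [xy]]; apply: By; exists x.
move=> e epos; have [N hN] := ay e epos; exists N => n Nn; apply: le_trans (hN n Nn).
rewrite /spherical_dist -mulrA ler_piMr ?mdist_ge0 //.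
by rewrite mulr_ile1 ?conformal_factor_ge0 ?conformal_factor_le1.
Qed.

Lemma spherical_nbhs (y : one_point_compactification Omegabar)
  (U : set (one_point_compactification Omegabar)) : nbhs y U ->
  exists2 r, 0 < r & forall z, q y z <= r -> U z.
Proof.
case: y => [y|]; last first.
  move=> [K [cK _] KU].
  have [M hM] : exists M : R, forall z, K z -> mdist (iota o) z <= M.
    have cd : {within K, continuous (fun z => mdist (iota o) z : R^o)}.
      apply: continuous_subspaceT => z; apply/cvgrPdist_lt => e e0.
      apply/nbhs_ballP; exists e => //= t; rewrite ballEmdist /= => zt.
      apply: le_lt_trans zt; rewrite ler_norml.
      have := metric_triangle (iota o) z t; have := metric_triangle (iota o) t z.
      by rewrite (metric_sym t); lra.
    have /compact_bounded[M [_ hM]] := continuous_compact cd cK.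
    exists (M + 1) => z Kz; have := hM (M + 1); rewrite ltrDl ltr01 => /(_ isT).
    move=> /(_ (mdist (iota o) z)) /= h; apply: le_trans (ler_norm _) _.
    by apply: h; exists z.
  have M1 : 0 < `|M| + 2 by rewrite ltr_wpDl.
  (* A conformal factor not above this value means a distance from [o] larger than [M], hence a
     point outside [K]. *)
  exists (`|M| + 2)^-1; first by rewrite invr_gt0.
  move=> [z|] hz; apply: KU; last by right.
  left; exists z => // Kz; move: hz; rewrite /= lef_pV2 ?posrE //; last first.
    by rewrite ltr_wpDr // mdist_ge0.
  by have := hM z Kz; have := ler_norm M; lra.
move=> /nbhs_ballP[r /= r0 rU].
set hy := conformal_factor (iota o) (Some y).
have hy0 : 0 < hy by exact: conformal_factor_gt0.
(* The first entry keeps [z] finite with factor at least [hy / 2]; the second then turns smallness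
   of [q] into smallness of [mdist]. *)
pose e := Num.min (hy / 2) (r * (hy * (hy / 2)) / 2).
have e0 : 0 < e by rewrite lt_min !divr_gt0 // !mulr_gt0 // divr_gt0.
exists e => // z; rewrite /e le_min => /andP[z1 z2].
have := conformal_factor_lip (iota o) (Some y) z; rewrite -/hy => lip.
case: z z1 z2 lip => [z|] z1 z2 lip; last first.
  have {}z1 : hy <= hy / 2 := z1.
  lra.
apply: rU; rewrite ballEmdist /=.
set hz := conformal_factor (iota o) (Some z) in lip.
have hz2 : hy / 2 <= hz.
  have : hy <= hz + hy / 2 := le_trans lip (lerD (lexx _) z1).
  lra.
have {}z2 : mdist y z * (hy * hz) <= r * (hy * (hy / 2)) / 2.
  by rewrite [leLHS]mulrA; exact: z2.
have p0 : 0 < hy * (hy / 2) by rewrite mulr_gt0 // divr_gt0.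
rewrite -(@ltr_pM2r _ (hy * (hy / 2))) //.
apply: le_lt_trans (_ : mdist y z * (hy * hz) < _).
  by rewrite ler_wpM2l ?mdist_ge0 // ler_pM2l.
apply: le_lt_trans z2 _.
have : 0 < r * (hy * (hy / 2)) by rewrite mulr_gt0.
lra.
Qed.

Variables (mu : {measure set (borel Omega) -> \bar R}) (Q : R).
Hypothesis ahl : ahlfors_regular Q mu.
Hypothesis unbounded : (metric_diam Omega = +oo)%E.

(** At infinity, the complement of a closed ball is a neighbourhood because Ahlfors regularity makes
    the ball compact. *)
Lemma nbhs_spherical (y : one_point_compactification Omegabar) (r : R) : 0 < r ->
  exists2 U, nbhs y U & forall z, U z -> q y z <= r.
Proof.
move=> r0; case: y => [y|].
  exists (Some @` ball y r).
    apply: one_point_compactification_some_nbhs; exact: nbhsx_ballx.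
  move=> _ [z yz <-]; move: yz; rewrite ballEmdist /= => /ltW; apply: le_trans.
  rewrite -mulrA ler_piMr ?mdist_ge0 //.
  by rewrite mulr_ile1 ?(conformal_factor_ge0 _ (Some _))
    ?(conformal_factor_le1 _ (Some _)).
have r1 : 0 < r^-1 by rewrite invr_gt0.
exists (Some @` (~` [set z | mdist (iota o) z <= r^-1]) `|` [set None]).
  exists [set z | mdist (iota o) z <= r^-1] => //; split.
    exact: (compact_metric_ball iota_isom dense_iota complete_bar ahl unbounded).
  exact: closed_metric_ball.
move=> _ [[z /negP + <-]|-> /=]; last exact: ltW.
rewrite -ltNge /= => oz; rewrite -[leRHS]invrK lef_pV2 ?posrE //; last first.
  by rewrite ltr_wpDr // mdist_ge0.
lra.
Qed.

Lemma spherical_dense (u : one_point_compactification Omegabar) (e : R) : 0 < e ->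
  exists x, q (Some (iota x)) u <= e.
Proof.
move=> e0; case: u => [y|].
  have [x xy] := dense_approx dense_iota y e0; exists x; apply: le_trans xy.
  rewrite /spherical_dist -mulrA ler_piMr ?mdist_ge0 //.
  by rewrite mulr_ile1 ?conformal_factor_ge0 ?conformal_factor_le1.
apply: contrapT => /forallNP no.
have bounded x : mdist o x <= e^-1.
  have /negP := no x; rewrite -ltNge [q _ _]/= -/(h x) hE => ex.
  have : (1 + mdist o x) <= e^-1.
    by rewrite -[leLHS]invrK lef_pV2 ?posrE ?invr_gt0 ?ltr_wpDr ?mdist_ge0 // ltW.
  lra.
have : (metric_diam Omega <= (2 * e^-1)%:E)%E.
  apply: ge_ereal_sup => _ [[x y] _ <-]; rewrite lee_fin /=.
  have := bounded x; have := bounded y; have := metric_triangle x o y.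
  by rewrite (metric_sym x o); lra.
by rewrite unbounded.
Qed.

Lemma unbounded_boundary_homeomorphic (w : Omega) :
  (\int[lebesgue_measure]_(t in `[1%R, +oo[) ((Num.sqrt (psi t))^-1)%:E < +oo)%E ->
  homeomorphic (gromov_boundary k w eps) (set_type (extended_boundary iota)).
Proof.
move=> int_psi.
have psi1_homo s t : 1 <= s -> s <= t -> Num.sqrt (psi s) <= Num.sqrt (psi t).
  by move=> s1 st; apply: ler_wsqrtr; apply: psi_homo st; exact: le_trans s1.
have psi1_gt0 s : 1 <= s -> 0 < Num.sqrt (psi s).
  by move=> s1; rewrite sqrtr_gt0; apply: psi_gt0; exact: lt_le_trans s1.
have cpsi : {within `[1, +oo[, continuous (Num.sqrt \o psi)}.
  apply/subspace_continuousP => x x1.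
  have /subspace_continuousP/(_ x x1) := psi_continuous.
  move=> /cvg_comp; apply; exact: sqrt_continuous.
have [S hS] := sum_le_integral psi1_homo psi1_gt0 cpsi int_psi.
have F00 := F0_ge1.
apply: (@uniform_boundary_homeomorphic R Omega k (fun x => F x) E
  (fun t => Num.sqrt (psi t)) delta eps 4 2 (phi 1) S (2 * F0) w
  (one_point_compactification Omegabar) (Some \o iota) q) => //.
- by rewrite ler1n.
- lra.
- exact: spherical_dist_ge0.
- exact: spherical_dist_sym.
- exact: spherical_dist_eq0.
- exact: spherical_dist_chain.
- by move=> x; rewrite mulr_gt0 // exprn_gt0.
- exact: spherical_dist_expR.
- exact: spherical_weight_expR.
- exact: spherical_uniform.
- move=> x y; apply: le_trans (spherical_dist_le _ _ _) _.
  have := conformal_factor_le1 (iota o) (Some (iota x)).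
  by have := conformal_factor_le1 (iota o) (Some (iota y)); rewrite /comp; lra.
- exact: spherical_complete.
- by move=> u _ e e0; exact: spherical_dense.
- exact: weight_le_spherical.
- by move=> y U _ /spherical_nbhs[r r0 rU]; exists r => // z _; exact: rU.
- by move=> y r _ /(nbhs_spherical y)[U nU hU]; exists U => // z _; exact: hU.
Qed.

End unbounded.

End uniform_spaces.

Theorem theorem1p8 (R : realType) (Omega : pmetricType R)
    (Omegabar : metricType R) (iota : Omega -> Omegabar)
    (mu : {measure set (borel Omega) -> \bar R})
    (Q c : R) (phi psi : R -> R) :
  is_completion iota ->
  1 < Q -> 1 <= c ->
  locally_compact [set: Omega] ->
  quasiconvex Omega c ->
  ahlfors_regular Q mu ->
  metric_boundary iota !=set0 ->
  nneg_homeo phi psi ->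
  roughly_starlike (quasihyperbolic iota) ->
  gromov_hyperbolic (quasihyperbolic iota) ->
  phi_uniform iota phi ->
  ((metric_diam Omega < +oo)%E ->
   (\int[lebesgue_measure]_(t in `[1%R, +oo[) ((psi t)^-1)%:E < +oo)%E ->
   forall (w : Omega) (eps : R),
     bourdon_parameter (quasihyperbolic iota) eps ->
     homeomorphic (gromov_boundary (quasihyperbolic iota) w eps)
                  (set_type (metric_boundary iota)))
  /\
  ((metric_diam Omega = +oo)%E ->
   (\int[lebesgue_measure]_(t in `[1%R, +oo[) ((Num.sqrt (psi t))^-1)%:E
      < +oo)%E ->
   forall (w : Omega) (eps : R),
     bourdon_parameter (quasihyperbolic iota) eps ->
     homeomorphic (gromov_boundary (quasihyperbolic iota) w eps)
                  (set_type (extended_boundary iota))).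
Proof.
move=> [isom dense_iota complete] _ _ lc qc ahl bd phi_psi starlike _ uniform.
split=> diam int_psi w eps [delta [delta0 k_delta /andP[eps0 _] eps_delta]].
  exact: (bounded_boundary_homeomorphic isom dense_iota complete lc qc bd
    phi_psi starlike uniform delta0 k_delta).
exact: (unbounded_boundary_homeomorphic isom dense_iota complete lc qc bd
  phi_psi starlike uniform delta0 k_delta eps0 eps_delta point ahl).
Qed.
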